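(* Let $\eta_t(\omega)$ be the random walk in random environment built from $\delta\in(0,1/2)$, $\alpha>0$ and the i.i.d. vectors $(\xi_i,Y_i)$ as described in the context. Suppose $\mathbb{E}[\zeta_1]=0$, $s^2\in(0,\infty)$, $Y_1/\xi_1\stackrel{d}{=}-Y_1/(1-\xi_1)$ (equality in distribution), $\sigma^2\in[0,\infty)$ and $\alpha>0$. (i) For $\mathbb{P}$-a.e. $\omega$, for any $\varepsilon>0$, we have $P$-a.s. that $$0\le\frac{\eta_t(\omega)}{(\log t)^2}\le(\log\log t)^{2+\varepsilon}$$ for all but finitely many $t$. (ii) On the other hand, for $\mathbb{P}$-a.e. $\omega$, for any $\varepsilon>0$, we have $P$-a.s. that $$\frac{\eta_t(\omega)}{(\log t)^2}\ge(\log\log\log t)^{-1-\varepsilon}$$ for infinitely many $t$.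
   Context: Environment. Fix $\delta\in(0,1/2)$ and $\alpha>0$. Let $(\xi_i,Y_i)$, $i\in\mathbb{N}=\{1,2,\dots\}$, be i.i.d. random vectors on a probability space $(\Omega,\mathcal{F},\mathbb{P})$ (with expectation $\mathbb{E}$ and variance $\mathrm{Var}$) such that $\mathbb{P}[\delta\le\xi_1\le 1-\delta]=1$ and $Y_1$ takes values in $[-1,1]$; $\xi_1$ and $Y_1$ may be dependent. Set $p_0=q_0=1/2$ and, for $n\ge1$, let $p_n$ be the truncation of $\xi_n+Y_nn^{-\alpha}$ to $[\delta/2,1-\delta/2]$, i.e. $p_n=\xi_n+Y_nn^{-\alpha}$ if this lies in $[\delta/2,1-\delta/2]$, $p_n=\delta/2$ if $\xi_n+Y_nn^{-\alpha}<\delta/2$, and $p_n=1-\delta/2$ if $\xi_n+Y_nn^{-\alpha}>1-\delta/2$; let $q_n=1-p_n$. The environment is $\omega=(p_0,p_1,p_2,\dots)$. Walk. Given $\omega$, $(\eta_t(\omega);t\in\mathbb{Z}^+)$, $\mathbb{Z}^+=\{0,1,2,\dots\}$, is the Markov chain on $\mathbb{Z}^+$ under the quenched probability $P$ (depending on $\omega$), with $\eta_0(\omega)=r$ for some fixed $r\in\mathbb{Z}^+$ and transition probabilities: from $n\ge1$, to $n-1$ with probability $p_n$ and to $n+1$ with probability $q_n$; from $0$, to $0$ with probability $p_0$ and to $1$ with probability $q_0$. Notation. $\zeta_n=\log\left(\frac{\xi_n}{1-\xi_n}\right)$, $s^2=\mathrm{Var}[\xi_1]$, $\sigma^2=\mathrm{Var}[Y_1]$.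 *)

(* Defs.v *)
From mathcomp Require Import all_boot all_order all_algebra.
From mathcomp Require Import all_classical all_reals all_analysis.

Set Implicit Arguments.
Unset Strict Implicit.
Unset Printing Implicit Defensive.

Import Order.TTheory GRing.Theory Num.Theory.
Import numFieldNormedType.Exports.

Local Open Scope classical_set_scope.
Local Open Scope ring_scope.

Definition eq_in_dist d (T : measurableType d) d' (S : measurableType d')
    (R : realType) (P : probability T R) (X Y : T -> S) : Prop :=
  forall A : set S, measurable A -> P (X @^-1` A) = P (Y @^-1` A).

Definition mutually_independent d (T : measurableType d)
    d' (S : measurableType d') (R : realType) (P : probability T R)
    (X : nat -> T -> S) : Prop :=
  forall (s : seq nat) (A : nat -> set S),
    uniq s -> (forall i, measurable (A i)) ->
    P (\bigcap_(i in [set` s]) (X i @^-1` A i)) =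
    (\prod_(i <- s) P (X i @^-1` A i))%E.

Definition iid d (T : measurableType d) d' (S : measurableType d')
    (R : realType) (P : probability T R) (X : nat -> T -> S) : Prop :=
  mutually_independent P X /\ forall i j, eq_in_dist P (X i) (X j).

Definition truncate (R : realType) (a b x : R) : R :=
  if x < a then a else if b < x then b else x.

(* The sequence (p_0, p_1, ...) at the sample point w; xi and Y are only used
   at indices n >= 1. *)
Definition environment (R : realType) (T : Type) (delta alpha : R)
    (xi Y : nat -> T -> R) (w : T) (n : nat) : R :=
  if n is 0%N then 1 / 2
  else truncate (delta / 2) (1 - delta / 2) (xi n w + Y n w * n%:R `^ (- alpha)).

Definition trans (R : realType) (p : nat -> R) (x y : nat) : R :=
  if x is x'.+1 then
    if y == x' then p x else if y == x.+1 then 1 - p x else 0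
  else
    if y == 0%N then p 0%N else if y == 1%N then 1 - p 0%N else 0.

(* The second clause is
     Q[eta_{t+1} = y | eta_0 = x_0, ..., eta_t = x_t] = trans p x_t y
   multiplied through by the probability of the conditioning event, so that
   null conditioning events impose no constraint. *)
Definition quenched_walk d (T : measurableType d) (R : realType)
    (p : nat -> R) (r : nat) (Q : probability T R)
    (eta : nat -> {RV Q >-> nat}) : Prop :=
  Q [set v | eta 0%N v = r] = 1%E /\
  forall (t : nat) (x : nat -> nat) (y : nat),
    let past := [set v | forall k, (k <= t)%N -> eta k v = x k] in
    Q (past `&` [set v | eta t.+1 v = y]) = (Q past * (trans p (x t) y)%:E)%E.

Definition zeta (R : realType) (T : Type) (xi : nat -> T -> R) (n : nat) (w : T)
    : R :=
  ln (xi n w / (1 - xi n w)).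

(* Main.v *)
Require Import Defs.
From mathcomp Require Import all_boot all_order all_algebra.
From mathcomp Require Import all_classical all_reals all_analysis.
From mathcomp Require Import measurable_realfun.
From mathcomp Require Import ring lra zify.

Set Implicit Arguments.
Unset Strict Implicit.
Unset Printing Implicit Defensive.

Import Order.TTheory GRing.Theory Num.Theory.
Import numFieldNormedType.Exports.

Local Open Scope classical_set_scope.
Local Open Scope ring_scope.

(* With X_n = log (p_n / (1 - p_n)), the potential V(n) = X_1 + ... + X_n governs
   the walk.  The X_n are independent and bounded; for n large, the equality in
   law of Y/xi and -Y/(1 - xi) makes them exactly centred, and their variance is
   bounded below.
   (i) Fourth moments give every block of length 4^k a conditional probability
   bounded below of an increment of order 2^k.  Hence almost surely, for all k
   large, one of k successive blocks is such a barrier V(j) - V(i) >= a 2^k, and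
   the function with increments exp (V(x) - V(i)), which is harmonic between i
   and j, shows that the walk needs more than exp (a 2^k / 2) steps to cross it;
   Borel-Cantelli over k concludes.
   (ii) Doob's inequality gives max |V| <= 2^m sqrt(log m) on [0, 4^m] with
   probability tending to 1, hence for infinitely many m almost surely; for such
   m, bounding the expected hitting time of 4^m by Markov's inequality puts it
   below exp (3 2^m sqrt(log m)) with probability close to 1. *)

(** * Independence of the past *)

(** With c = n^(-alpha), the log-odds of xi + c Y split as log (xi / (1 - xi)) + log (1 + c Y / xi)
    - log (1 - c Y / (1 - xi)). The last two logarithms have the same law, so they cancel in mean
    for every alpha > 0: the perturbation adds no drift, however slowly c decays. Only finitely many
    sites, where the truncation may act, can fail to be centred. Conditioning on the past is
    expressed by integrating against a bounded nonnegative weight that depends on the past only;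
    moments of orders 1, 2 and 4 then suffice. The walk is given by its cylinder probabilities, so
    hitting times are studied through the law of the walk killed on reaching a level. In (i), log t
    of order 2^k makes k of order log log t and k 4^k of order (log t)^2 log log t; the spare power
    of log log t absorbs the constants. In (ii), (log t)^2 is at most 9 log m times 4^m, and log m
    is at most of order log log log t unless log t <= 2^m, a case in which the bound is
    immediate. *)

Section Independence.
Context d (T : measurableType d) d' (S : measurableType d') (R : realType).
Variables (P : probability T R) (Z : nat -> T -> S).
Hypothesis mZ : forall i, measurable_fun setT (Z i).
Hypothesis indepZ : mutually_independent P Z.

Definition cylinders (k : nat) : set (set T) :=
  [set C | exists2 A : nat -> set S, (forall i, measurable (A i)) &
           C = \bigcap_(i < k) (Z i @^-1` A i)].

(** Retyping the domain of [f] expresses measurability with respect to Z_0, ..., Z_(k-1), so that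
    the closure properties of [measurable_fun] apply unchanged. *)
Definition past_measurable (k : nat) (f : T -> R) :=
  measurable_fun [set: g_sigma_algebraType (cylinders k)]
                 (f : g_sigma_algebraType (cylinders k) -> R).

Lemma cylinders_measurable k : cylinders k `<=` measurable.
Proof.
move=> _ [A mA ->]; apply: bigcap_measurableType => i _.
by rewrite -[X in measurable X]setTI; exact: mZ.
Qed.

Lemma past_sets_measurable k A : <<s cylinders k >> A -> measurable A.
Proof.
move: A; apply: smallest_sub => //; last exact: cylinders_measurable.
exact: sigma_algebra_measurable.
Qed.

Lemma past_measurable_fun k f : past_measurable k f -> measurable_fun setT f.
Proof.
move=> mf _ B mB; apply: (@past_sets_measurable k).
exact: mf.
Qed.

Lemma cylinders_setI k : setI_closed (cylinders k).
Proof.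
move=> _ _ [A mA ->] [B mB ->].
exists (fun i => A i `&` B i); first by move=> i; exact: measurableI.
by rewrite -bigcapI.
Qed.

Lemma cylindersT k : cylinders k setT.
Proof.
exists (fun=> setT); first by [].
by apply/esym/seteqP; split => // x _ i _.
Qed.

Lemma cylinders_next k (B : set S) :
  measurable B -> cylinders k.+1 (Z k @^-1` B).
Proof.
move=> mB; exists (fun i => if i == k then B else setT).
  by move=> i; case: ifP.
apply/seteqP; split => [w Bw i _ /=|w /(_ k)].
  by case: eqP => // ->.
by rewrite /= eqxx; apply; exact: ltnSn.
Qed.

Lemma cylinders_widen k : cylinders k `<=` cylinders k.+1.
Proof.
move=> _ [A mA ->]; exists (fun i => if i == k then setT else A i).
  by move=> i; case: ifP.
apply/seteqP; split => [w Aw i /= ik|w Aw i /= ik].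
  case: eqP => // /eqP nk; apply: Aw => /=.
  by move: ik nk; lia.
have := Aw i; rewrite /= ifF; last by lia.
by apply; lia.
Qed.

Lemma past_measurable_widen k f :
  past_measurable k f -> past_measurable k.+1 f.
Proof.
move=> mf _ B mB.
have := mf measurableT B mB; apply: sub_sigma_algebra2.
exact: cylinders_widen.
Qed.

Lemma past_measurable_le k l f :
  (k <= l)%N -> past_measurable k f -> past_measurable l f.
Proof.
move=> /subnKC <-; elim: (l - k)%N => [|m IH]; first by rewrite addn0.
by rewrite addnS => /IH; exact: past_measurable_widen.
Qed.

Lemma past_measurable_next k (g : S -> R) :
  measurable_fun setT g -> past_measurable k.+1 (g \o Z k).
Proof.
move=> mg _ B mB; apply: sub_sigma_algebra.
rewrite setTI comp_preimage; apply: cylinders_next.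
by rewrite -[X in measurable X]setTI; exact: mg.
Qed.

(** Both sides are finite measures in A. They agree on the cylinders, which are stable under
    intersection, hence on the sigma-algebra that these generate. *)
Lemma past_setI_indep k A B : <<s cylinders k >> A -> measurable B ->
  P (A `&` Z k @^-1` B) = (P A * P (Z k @^-1` B))%E.
Proof.
move=> kA mB.
have mE : measurable (Z k @^-1` B).
  by rewrite -[X in measurable X]setTI; exact: mZ.
have Efin : P (Z k @^-1` B) \is a fin_num by rewrite fin_num_measure.
pose c : {nonneg R} := NngNum (fine_ge0 (measure_ge0 P (Z k @^-1` B))).
pose m1 : {measure set T -> \bar R} := mrestr P mE.
pose m2 : {measure set T -> \bar R} := mscale c P.
have : m1 A = m2 A.
  apply: (g_sigma_algebra_measure_unique (cylinders k) _ (fun=> setT) _ _ m1 m2)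
    => //.
  - exact: cylinders_measurable.
  - by move=> _; exact: cylindersT.
  - by apply/seteqP; split => // x _; exists 0%N.
  - exact: cylinders_setI.
  - move=> _ [C mC ->]; rewrite /m1 /m2 /= /mrestr /mscale /= fineK//.
    have iotaE l : [set` iota 0 l] = `I_l.
      by apply/seteqP; split => i /=; rewrite mem_iota; lia.
    have := indepZ (iota_uniq 0 k) mC; rewrite iotaE.
    (* Inserting B at index k reduces the claim to independence over the indices 0, ..., k. *)
    pose C' i := if i == k then B else C i.
    have mC' i : measurable (C' i) by rewrite /C'; case: ifP.
    move=> PC.
    have := indepZ (iota_uniq 0 k.+1) mC'; rewrite iotaE.
    rewrite (_ : \bigcap_(i in _) _ =
      \bigcap_(i in `I_k) Z i @^-1` C i `&` Z k @^-1` B); last first.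
      apply/seteqP; split => [w Cw|w [Cw Bw] i /= ik].
        split.
          move=> i /= ik; have := Cw i; rewrite /C' ifF.
            by apply => /=; lia.
          by lia.
        by have := Cw k; rewrite /C' eqxx; apply => /=; lia.
      rewrite /C'; case: eqP => [->//|/eqP nk]; apply: Cw => /=.
      by lia.
    move=> ->; rewrite -addn1 iotaD big_cat /= big_seq1 add0n /C' eqxx.
    rewrite [RHS]muleC PC; congr (_ * _)%E.
    apply: eq_big_seq => i; rewrite mem_iota => ik.
    by rewrite ifF//; lia.
  - move=> _; rewrite /m1 /= /mrestr /= setTI.
    by rewrite ltey_eq Efin.
by rewrite /m1 /m2 /= /mrestr /mscale /= fineK// muleC.
Qed.

End Independence.

(** * Expectation of a product of bounded independent variables *)

Section BoundedRintegral.
Context d (T : measurableType d) (R : realType) (P : probability T R).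
Implicit Types f g : T -> R.

Lemma bounded_probability_integrable f (M : R) : measurable_fun setT f ->
  (forall w, `|f w| <= M) -> P.-integrable setT (EFin \o f).
Proof.
move=> mf fM; apply: measurable_bounded_integrable => //.
  by rewrite ltey_eq fin_num_measure.
exists M; split; first exact: num_real.
by move=> x Mx w _ /=; rewrite (le_trans (fM w))// ltW.
Qed.

Lemma Rintegral_cst_probability (c : R) : \int[P]_w c = c.
Proof.
rewrite Rintegral_cst// -[RHS]mulr1; congr (_ * _).
rewrite -[RHS]/(fine 1%E); congr fine; exact: probability_setT.
Qed.

Lemma indep_integralM_ge0 (X Y : {RV P >-> R}) :
  (forall A B, measurable A -> measurable B ->
    P (X @^-1` A `&` Y @^-1` B) = (P (X @^-1` A) * P (Y @^-1` B))%E) ->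
  (forall w, 0 <= X w) -> (forall w, 0 <= Y w) ->
  (\int[P]_w (X w * Y w)%:E = \int[P]_w (X w)%:E * \int[P]_w (Y w)%:E)%E.
Proof.
move=> indep X0 Y0.
have mXY : measurable_fun setT (fun w => (X w, Y w)).
  by apply: measurable_fun_pair; exact: measurable_funPT.
pose XY : {RV P >-> (R * R)%type} := mfun_Sub (mem_set mXY).
(* Absolute values make the integrand nonnegative on the whole plane, as Tonelli requires; on the
   range of (X, Y) they change nothing. *)
pose h : R * R -> \bar R := fun z => (`|z.1| * `|z.2|)%:E.
have mh : measurable_fun setT h.
  apply/measurable_EFinP; apply: measurable_funM;
    by apply: measurableT_comp => //.
have h0 z : (0 <= h z)%E by rewrite lee_fin mulr_ge0.
transitivity (\int[distribution P XY]_z h z)%E.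
  rewrite ge0_integral_distribution//; apply: eq_integral => w _.
  by rewrite /h /= !ger0_norm.
(* The joint law agrees with the product of the marginals on rectangles, hence everywhere. *)
transitivity (\int[distribution P X \x distribution P Y]_z h z)%E.
  apply: eq_measure_integral => A mA _; symmetry.
  exact: product_measure_unique.
rewrite fubini_tonelli1// /fubini_F /h.
transitivity (\int[distribution P X]_x (`|x|%:E * \int[P]_w (Y w)%:E))%E.
  apply: eq_integral => x _ /=.
  under eq_integral do rewrite EFinM.
  rewrite ge0_integralZl//; last by apply/measurable_EFinP.
  congr (_ * _)%E; rewrite ge0_integral_distribution//.
    by apply: eq_integral => w _ /=; rewrite ger0_norm.
  by apply/measurable_EFinP.
rewrite ge0_integralZr//.
- congr (_ * _)%E; rewrite ge0_integral_distribution//.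
    by apply: eq_integral => w _ /=; rewrite ger0_norm.
  by apply/measurable_EFinP.
- by apply/measurable_EFinP.
- by apply: integral_ge0 => w _; rewrite lee_fin.
Qed.

(** X + M and Y + M are nonnegative and still independent; the identity for them gives the one for X
    and Y after expanding the product. *)
Lemma indep_RintegralM (X Y : {RV P >-> R}) (M : R) :
  (forall A B, measurable A -> measurable B ->
    P (X @^-1` A `&` Y @^-1` B) = (P (X @^-1` A) * P (Y @^-1` B))%E) ->
  (forall w, `|X w| <= M) -> (forall w, `|Y w| <= M) ->
  \int[P]_w (X w * Y w) = \int[P]_w X w * \int[P]_w Y w.
Proof.
move=> indep XM YM.
have M0 : 0 <= M by apply: (le_trans _ (XM point)).
have mX : measurable_fun setT X by exact: measurable_funPT.
have mY : measurable_fun setT Y by exact: measurable_funPT.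
have mX' : measurable_fun setT (fun w => X w + M) by exact: measurable_funD.
have mY' : measurable_fun setT (fun w => Y w + M) by exact: measurable_funD.
have iX := bounded_probability_integrable mX XM.
have iY := bounded_probability_integrable mY YM.
have iM : P.-integrable setT (EFin \o (fun=> M : R)).
  by apply: (@bounded_probability_integrable _ M) => // w; rewrite ger0_norm.
have iXY : P.-integrable setT (EFin \o (fun w => X w * Y w)).
  apply: (@bounded_probability_integrable _ (M * M)); first exact: measurable_funM.
  by move=> w; rewrite normrM ler_pM.
have iX' : P.-integrable setT (EFin \o (fun w => X w + M)).
  apply: (@bounded_probability_integrable _ (M + M)) => // w.
  by rewrite (le_trans (ler_normD _ _))// lerD// ger0_norm.
have iY' : P.-integrable setT (EFin \o (fun w => Y w + M)).
  apply: (@bounded_probability_integrable _ (M + M)) => // w.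
  by rewrite (le_trans (ler_normD _ _))// lerD// ger0_norm.
pose X' : {RV P >-> R} := mfun_Sub (mem_set mX').
pose Y' : {RV P >-> R} := mfun_Sub (mem_set mY').
have : (\int[P]_w (X' w * Y' w)%:E = \int[P]_w (X' w)%:E * \int[P]_w (Y' w)%:E)%E.
  apply: indep_integralM_ge0 => [A B mA mB|w|w].
  - have mt (C : set R) : measurable C ->
        measurable ((fun x : R => x + M) @^-1` C).
      move=> mC; rewrite -[X in measurable X]setTI.
      by apply: (@measurable_funD _ _ _ _ id (cst M)).
    have := indep _ _ (mt A mA) (mt B mB).
    by [].
  - by rewrite /=; have := XM w; rewrite ler_norml; lra.
  - by rewrite /=; have := YM w; rewrite ler_norml; lra.
move/(congr1 fine); rewrite fineM; last 2 first.
- exact: integrable_fin_num.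
- exact: integrable_fin_num.
have E1 (Z : T -> R) : P.-integrable setT (EFin \o Z) ->
    \int[P]_w (Z w + M) = \int[P]_w Z w + M.
  move=> iZ; rewrite RintegralD//; congr (_ + _).
  by rewrite Rintegral_cst_probability.
rewrite -!/(Rintegral _ _ _) /= !E1//.
have -> : \int[P]_w ((X w + M) * (Y w + M)) =
   \int[P]_w (X w * Y w) + M * \int[P]_w X w + M * \int[P]_w Y w + M * M.
  have iMX : P.-integrable setT (EFin \o (fun w => M * X w)).
    apply: (@bounded_probability_integrable _ (M * M)).
      exact: measurable_funM.
    by move=> w; rewrite normrM ler_pM// ger0_norm.
  have iMY : P.-integrable setT (EFin \o (fun w => M * Y w)).
    apply: (@bounded_probability_integrable _ (M * M)).
      exact: measurable_funM.
    by move=> w; rewrite normrM ler_pM// ger0_norm.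
  have iXYM : P.-integrable setT (EFin \o (fun w => X w * Y w + M * X w)).
    apply: (@bounded_probability_integrable _ (M * M + M * M)).
      by apply: measurable_funD; exact: measurable_funM.
    move=> w; rewrite (le_trans (ler_normD _ _))// lerD// normrM ler_pM//.
    by rewrite ger0_norm.
  rewrite -(RintegralZl _ _ iX)// -(RintegralZl _ _ iY)//.
  rewrite -RintegralD// -RintegralD//.
  have -> : M * M = \int[P]_w (M * M).
    by rewrite Rintegral_cst_probability.
  rewrite -RintegralD//.
  - by apply: eq_Rintegral => w _; ring.
  - apply: (@bounded_probability_integrable _ (M * M + M * M + M * M)).
      by apply: measurable_funD; [apply: measurable_funD|];
        exact: measurable_funM.
    move=> w; rewrite (le_trans (ler_normD _ _))// lerD//.
      rewrite (le_trans (ler_normD _ _))// lerD// normrM ler_pM//.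
      by rewrite ger0_norm.
    by rewrite normrM ler_pM// ger0_norm.
  - apply: (@bounded_probability_integrable _ (M * M)) => // w.
    by rewrite ger0_norm// mulr_ge0.
lra.
Qed.

End BoundedRintegral.

Section MeasurableLevelSets.
Context d (T : measurableType d) (R : realType) (f : T -> R).
Hypothesis mf : measurable_fun setT f.

Lemma measurable_superlevel c : measurable [set w | c <= f w].
Proof.
rewrite -[X in measurable X]setTI.
have := mf measurableT (measurable_itv `[c, +oo[).
by congr (measurable (_ `&` _)); apply/seteqP; split => w /=; rewrite in_itv /= andbT.
Qed.

Lemma measurable_sublevel c : measurable [set w | f w <= c].
Proof.
rewrite -[X in measurable X]setTI.
have := mf measurableT (measurable_itv `]-oo, c]).
by congr (measurable (_ `&` _)); apply/seteqP; split => w /=; rewrite in_itv.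
Qed.

End MeasurableLevelSets.

Section MartingaleDifferences.
Context d (T : measurableType d) d' (S : measurableType d') (R : realType).
Variables (P : probability T R) (Z : nat -> T -> S).
Hypothesis mZ : forall i, measurable_fun setT (Z i).
Hypothesis indepZ : mutually_independent P Z.

Lemma past_RintegralM k (f : T -> R) (g : S -> R) (M : R) :
  past_measurable Z k f -> measurable_fun setT g ->
  (forall w, `|f w| <= M) -> (forall z, `|g z| <= M) ->
  \int[P]_w (f w * g (Z k w)) = \int[P]_w f w * \int[P]_w g (Z k w).
Proof.
move=> kf mg fM gM.
have mf : measurable_fun setT f := past_measurable_fun mZ kf.
have mgZ : measurable_fun setT (g \o Z k) by exact: measurableT_comp.
pose X : {RV P >-> R} := mfun_Sub (mem_set mf).
pose Y : {RV P >-> R} := mfun_Sub (mem_set mgZ).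
apply: (@indep_RintegralM _ _ _ P X Y M) => // [A B mA mB|w]; last exact: gM.
rewrite /X /Y /= comp_preimage; apply: (past_setI_indep mZ indepZ).
  by have := kf measurableT A mA; rewrite setTI.
by rewrite -[X in measurable X]setTI; exact: mg.
Qed.

End MartingaleDifferences.

(** * Sums of independent centred bounded variables *)

Section QuarticTest.
Context (R : realType).
Implicit Types (a b c s v x : R).

(** With [quartic_le0], this places x / 2 + x^2 - x^4 below the indicator of x > 0. For a centred
    sum the linear term has mean zero, so the mean of the polynomial is positive once the second
    moment beats the fourth. *)
Lemma quartic_le1 x : x / 2 + x ^+ 2 - x ^+ 4 <= 1.
Proof.
rewrite -subr_ge0 (_ : _ - _ =
  (x ^+ 2 - 3 / 4) ^+ 2 + (x - 1 / 2) ^+ 2 / 2 + 5 / 16); last by field.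
by have := sqr_ge0 (x ^+ 2 - 3 / 4); have := sqr_ge0 (x - 1 / 2); lra.
Qed.

Lemma quartic_le0 x : x <= 0 -> x / 2 + x ^+ 2 - x ^+ 4 <= 0.
Proof.
move=> x0; have [x1|x1] := leP (- 1) x.
  have -> : x / 2 + x ^+ 2 - x ^+ 4 =
    x * ((x + 1 / 2) ^+ 2 * (1 - x) + (1 + x) / 4) by field.
  apply: mulr_le0_ge0 => //; apply: addr_ge0; last by lra.
  by apply: mulr_ge0; [exact: sqr_ge0|lra].
have -> : x / 2 + x ^+ 2 - x ^+ 4 = x / 2 + x ^+ 2 * (1 - x ^+ 2) by ring.
have x2 : 1 <= x ^+ 2 by nra.
have : x ^+ 2 * (1 - x ^+ 2) <= 0 by rewrite mulr_ge0_le0 ?sqr_ge0//; lra.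
by move: (_ * _) => y; lra.
Qed.

(* Bounds the probability of {s > a c} from below by the moments of s of orders
   1, 2 and 4. *)
Lemma quartic_test_indicator s a b c v :
  0 < b -> 0 < c -> 0 <= v -> a ^+ 2 + b * a / 2 <= v / 4 ->
  b / (2 * c) * s + c ^- 2 * s ^+ 2 - b ^- 2 * c ^- 4 * s ^+ 4 - v / 4
  <= b ^+ 2 * (a * c < s)%R%:R.
Proof.
move=> b0 c0 v0 abv.
have bn0 : b != 0 by rewrite gt_eqF.
have cn0 : c != 0 by rewrite gt_eqF.
(* In units of b c the test function is b^2 times the quartic, minus v / 4. *)
have sE : s = s / (b * c) * (b * c) by rewrite divfK// mulf_neq0.
move: (s / (b * c)) sE => x ->.
have -> : b / (2 * c) * (x * (b * c)) + c ^- 2 * (x * (b * c)) ^+ 2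
      - b ^- 2 * c ^- 4 * (x * (b * c)) ^+ 4 - v / 4 =
    b ^+ 2 * (x / 2 + x ^+ 2 - x ^+ 4) - v / 4.
  by field; rewrite bn0 cn0.
rewrite (_ : x * (b * c) = (b * x) * c); last by ring.
rewrite ltr_pM2r//; case: (ltP a (b * x)) => bxa /=.
  by have := ler_wpM2l (sqr_ge0 b) (quartic_le1 x); lra.
(* Below the threshold the left side must be nonpositive: for x <= 0 the quartic already is, and for
   0 < b x <= a the hypothesis on a keeps it under v / 4. *)
have [x0|x0] := leP x 0.
  by have := ler_wpM2l (sqr_ge0 b) (quartic_le0 x0); lra.
have bx0 : 0 <= b * x by rewrite mulr_ge0// ltW.
have xx : (b * x) ^+ 2 <= a ^+ 2.
  by rewrite lerXn2r ?nnegrE// (le_trans bx0).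
have bx : b * (b * x) <= b * a by rewrite ler_wpM2l// ltW.
have x4 : 0 <= b ^+ 2 * x ^+ 4 by rewrite mulr_ge0 ?exprn_even_ge0.
rewrite mulr0; move: xx bx; rewrite exprMn => xx bx.
by rewrite mulrBr mulrDr; lra.
Qed.

End QuarticTest.

(** * Bounded functions of the past *)

Section BoundedPast.
Context d (T : measurableType d) d' (S : measurableType d') (R : realType).
Variables (P : probability T R) (Z : nat -> T -> S).
Hypothesis mZ : forall i, measurable_fun setT (Z i).
Implicit Types f g : T -> R.

(** This class contains the constants, is stable under sums, products, maxima and threshold
    indicators, and consists of integrable functions, so integrals of the expressions below can be
    split freely. *)
Definition bounded_past k f :=
  past_measurable Z k f /\ exists M : R, forall w, `|f w| <= M.

Lemma bounded_past_integrable k f :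
  bounded_past k f -> P.-integrable setT (EFin \o f).
Proof.
move=> [mf [M fM]].
exact: (bounded_probability_integrable P (past_measurable_fun mZ mf) fM).
Qed.

Lemma bounded_past_cst k (c : R) : bounded_past k (fun=> c).
Proof. by split; [exact: measurable_cst|exists `|c|]. Qed.

Lemma bounded_pastD k f g : bounded_past k f -> bounded_past k g ->
  bounded_past k (fun w => f w + g w).
Proof.
move=> [mf [M fM]] [mg [N gN]]; split; first exact: measurable_funD.
by exists (M + N) => w; rewrite (le_trans (ler_normD _ _))// lerD.
Qed.

Lemma bounded_pastM k f g : bounded_past k f -> bounded_past k g ->
  bounded_past k (fun w => f w * g w).
Proof.
move=> [mf [M fM]] [mg [N gN]]; split; first exact: measurable_funM.
by exists (M * N) => w; rewrite normrM ler_pM.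
Qed.

Lemma bounded_pastN k f : bounded_past k f -> bounded_past k (fun w => - f w).
Proof.
move=> kf; under eq_fun do rewrite -mulN1r.
by apply: bounded_pastM => //; exact: bounded_past_cst.
Qed.

Lemma bounded_pastB k f g : bounded_past k f -> bounded_past k g ->
  bounded_past k (fun w => f w - g w).
Proof. by move=> kf kg; apply: bounded_pastD => //; exact: bounded_pastN. Qed.

Lemma bounded_pastX k f n : bounded_past k f ->
  bounded_past k (fun w => f w ^+ n).
Proof.
move=> kf; elim: n => [|n IH].
  by under eq_fun do rewrite expr0; exact: bounded_past_cst.
by under eq_fun do rewrite exprS; exact: bounded_pastM.
Qed.

Lemma bounded_past_max k f g : bounded_past k f -> bounded_past k g ->
  bounded_past k (fun w => Num.max (f w) (g w)).
Proof.
move=> [mf [M fM]] [mg [N gN]]; split; first exact: measurable_maxr.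
exists (M + N) => w.
have M0 := le_trans (normr_ge0 _) (fM w).
have N0 := le_trans (normr_ge0 _) (gN w).
rewrite /Num.max; case: ifP => _.
  by rewrite (le_trans (gN w))// lerDr.
by rewrite (le_trans (fM w))// lerDl.
Qed.

Lemma bounded_past_gt k f (c : R) : bounded_past k f ->
  bounded_past k (fun w => (c < f w)%R%:R).
Proof.
move=> [mf _]; split; last first.
  by exists 1 => w; rewrite normr_nat lern1 leq_b1.
rewrite (_ : (fun w => _) = (\1_(`]c, +oo[%classic) : R -> R) \o f); last first.
  apply/funext => w; rewrite /= indicE; congr ((nat_of_bool _)%:R).
  by apply/idP/idP; rewrite inE /= in_itv /= andbT.
by apply: measurableT_comp mf; exact: measurable_indic.
Qed.

Lemma bounded_past_widen k l f :
  (k <= l)%N -> bounded_past k f -> bounded_past l f.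
Proof.
by move=> kl [mf M]; split => //; exact: past_measurable_le kl mf.
Qed.

Lemma bounded_past_next k l (g : S -> R) (M : R) : (k < l)%N ->
  measurable_fun setT g -> (forall z, `|g z| <= M) ->
  bounded_past l (fun w => g (Z k w)).
Proof.
move=> kl mg gM; apply: (@bounded_past_widen k.+1) => //.
by split; [exact: past_measurable_next|exists M].
Qed.

Lemma bounded_past_sum k (I : eqType) (s : seq I) (F : I -> T -> R) :
  (forall i, i \in s -> bounded_past k (F i)) ->
  bounded_past k (fun w => \sum_(i <- s) F i w).
Proof.
elim: s => [_|i s IH kF].
  by under eq_fun do rewrite big_nil; exact: bounded_past_cst.
under eq_fun do rewrite big_cons.
apply: bounded_pastD; first by apply: kF; rewrite mem_head.
by apply: IH => j js; apply: kF; rewrite in_cons js orbT.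
Qed.

Lemma bounded_past_ED k f g : bounded_past k f -> bounded_past k g ->
  \int[P]_w (f w + g w) = \int[P]_w f w + \int[P]_w g w.
Proof.
move=> kf kg.
exact: (RintegralD _ (bounded_past_integrable kf) (bounded_past_integrable kg)).
Qed.

Lemma bounded_past_EB k f g : bounded_past k f -> bounded_past k g ->
  \int[P]_w (f w - g w) = \int[P]_w f w - \int[P]_w g w.
Proof.
move=> kf kg.
exact: (RintegralB _ (bounded_past_integrable kf) (bounded_past_integrable kg)).
Qed.

Lemma bounded_past_EZ k f (c : R) : bounded_past k f ->
  \int[P]_w (c * f w) = c * \int[P]_w f w.
Proof.
by move=> kf; rewrite RintegralZl//; exact: bounded_past_integrable kf.
Qed.

Lemma bounded_past_le k f g : bounded_past k f -> bounded_past k g ->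
  (forall w, f w <= g w) -> \int[P]_w f w <= \int[P]_w g w.
Proof.
move=> kf kg fg; apply: le_Rintegral => //.
  exact: bounded_past_integrable kf.
exact: bounded_past_integrable kg.
Qed.

Lemma bounded_past_markov k f (c : R) : 0 < c -> bounded_past k f ->
  (forall w, 0 <= f w) ->
  (P [set w | (c <= f w)%R] <= ((\int[P]_w f w) / c)%:E)%E.
Proof.
move=> c0 kf f0; have mf := past_measurable_fun mZ kf.1.
have mA : measurable [set w | c <= f w] by exact: measurable_superlevel.
have -> : P [set w | (c <= f w)%R] = (\int[P]_w (\1_[set w | c <= f w] w))%:E.
  rewrite /Rintegral integral_indic// setIT fineK// fin_num_measure//.
rewrite lee_fin ler_pdivlMr// -RintegralZr//; last first.
  apply: (@bounded_probability_integrable _ _ _ P _ 1) => // w.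
  by rewrite indicE normr_nat lern1 leq_b1.
apply: le_Rintegral => //; last first.
- move=> w _; rewrite indicE; case: (boolP (w \in _)) => [/set_mem/= cf|_].
    by rewrite mul1r.
  by rewrite mul0r.
- exact: bounded_past_integrable kf.
- apply: (@bounded_probability_integrable _ _ _ P _ `|c|) => //.
    exact: measurable_funM.
  move=> w; rewrite normrM indicE normr_nat.
  by case: (_ \in _); rewrite ?mul1r ?mul0r.
Qed.

End BoundedPast.

(** * Conditional moments of increments and block jumps *)

Section Moments.
Context d (T : measurableType d) d' (S : measurableType d') (R : realType).
Variables (P : probability T R) (Z : nat -> T -> S).
Hypothesis mZ : forall i, measurable_fun setT (Z i).
Hypothesis indepZ : mutually_independent P Z.
Variables (phi : nat -> S -> R) (K : R) (n0 : nat).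
Hypothesis mphi : forall l, measurable_fun setT (phi l).
Hypothesis phiK : forall l z, `|phi l z| <= K.
Hypothesis phi0 : forall l, (n0 <= l)%N -> \int[P]_w phi l (Z l w) = 0.
Let X l w := phi l (Z l w).
Definition increment_sum i m w := \sum_(i <= l < i + m) X l w.
Local Notation Sum := increment_sum.
Local Notation bp := (bounded_past Z).

Lemma K_ge0 : 0 <= K.
Proof. exact: le_trans (normr_ge0 _) (phiK 0 point). Qed.

Lemma bounded_past_X k l : (l < k)%N -> bp k (X l).
Proof.
move=> lk; exact: (@bounded_past_next _ _ _ _ _ _ l k (phi l) K lk (mphi l)).
Qed.

Lemma bounded_past_increment_sum k i m : (i + m <= k)%N -> bp k (Sum i m).
Proof.
move=> imk; apply: bounded_past_sum => l; rewrite mem_index_iota => lim.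
by apply: bounded_past_X; lia.
Qed.

Lemma increment_sumS i m w : Sum i m.+1 w = Sum i m w + X (i + m)%N w.
Proof. by rewrite /increment_sum addnS big_nat_recr//= leq_addr. Qed.

Lemma increment_sum0 i w : Sum i 0 w = 0.
Proof. by rewrite /increment_sum addn0 big_geq. Qed.

(** Integrated form of the martingale-difference property: with [f] ranging over bounded functions
    of the past, it says that X_l has conditional mean zero. *)
Lemma Rintegral_past_X l f : (n0 <= l)%N -> bp l f ->
  \int[P]_w (f w * X l w) = 0.
Proof.
move=> nl [lf [M fM]].
rewrite (@past_RintegralM _ _ _ _ _ P Z mZ indepZ l f (phi l) (M + K))//.
- by rewrite phi0// mulr0.
- by move=> w; rewrite (le_trans (fM w))// lerDl K_ge0.
- move=> z; rewrite (le_trans (phiK l z))// lerDr.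
  exact: le_trans (normr_ge0 _) (fM point).
Qed.

Lemma Rintegral_past_X2_le l f : bp l f -> (forall w, 0 <= f w) ->
  \int[P]_w (f w * X l w ^+ 2) <= K ^+ 2 * \int[P]_w f w.
Proof.
move=> lf f0; rewrite -(bounded_past_EZ P mZ (K ^+ 2) lf).
have lf' := bounded_past_widen (leqnSn l) lf.
apply: (bounded_past_le P mZ (k := l.+1)).
- by apply: bounded_pastM => //; apply: bounded_pastX; exact: bounded_past_X.
- by apply: bounded_pastM => //; exact: bounded_past_cst.
- move=> w; rewrite mulrC ler_wpM2r// -[X in X <= _]real_normK ?num_real//.
  by rewrite lerXn2r ?nnegrE ?K_ge0// phiK.
Qed.

Lemma Rintegral_increment_sum i m f : (n0 <= i)%N -> bp i f ->
  \int[P]_w (f w * Sum i m w) = 0.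
Proof.
move=> ni kf; elim: m => [|m IH].
  under eq_Rintegral do rewrite increment_sum0 mulr0.
  by rewrite Rintegral_cst_probability.
have kf' : bp (i + m.+1) f by apply: bounded_past_widen kf; lia.
under eq_Rintegral do rewrite increment_sumS mulrDr.
rewrite (bounded_past_ED P mZ (k := (i + m.+1)%N)).
- rewrite IH add0r Rintegral_past_X//; first by lia.
  by apply: bounded_past_widen kf; lia.
- by apply: bounded_pastM => //; apply: bounded_past_increment_sum; lia.
- by apply: bounded_pastM => //; apply: bounded_past_X; lia.
Qed.

(** The cross term 2 f S X vanishes because f S depends on the past of X only. *)
Lemma Rintegral_increment_sum2_step i m f : (n0 <= i)%N -> bp i f ->
  \int[P]_w (f w * Sum i m.+1 w ^+ 2) =
  \int[P]_w (f w * Sum i m w ^+ 2) + \int[P]_w (f w * X (i + m)%N w ^+ 2).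
Proof.
move=> ni kf.
have kf' : bp (i + m) f by apply: bounded_past_widen kf; lia.
have kf'' : bp (i + m.+1) f by apply: bounded_past_widen kf; lia.
have kS : bp (i + m) (Sum i m) by apply: bounded_past_increment_sum; lia.
have kS' : bp (i + m.+1) (Sum i m) by apply: bounded_past_increment_sum; lia.
have kX : bp (i + m.+1) (X (i + m)%N) by apply: bounded_past_X; lia.
have E w : f w * Sum i m.+1 w ^+ 2 =
    f w * Sum i m w ^+ 2 + 2 * f w * Sum i m w * X (i + m)%N w
    + f w * X (i + m)%N w ^+ 2 by rewrite increment_sumS; ring.
under eq_Rintegral do rewrite E.
have k1 : bp (i + m.+1) (fun w => f w * Sum i m w ^+ 2).
  by apply: bounded_pastM => //; exact: bounded_pastX.
have k2 : bp (i + m) (fun w => 2 * f w * Sum i m w).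
  apply: bounded_pastM => //; apply: bounded_pastM => //.
  exact: bounded_past_cst.
have k2' : bp (i + m.+1) (fun w => 2 * f w * Sum i m w * X (i + m)%N w).
  by apply: bounded_pastM => //; apply: bounded_past_widen k2; lia.
have k3 : bp (i + m.+1) (fun w => f w * X (i + m)%N w ^+ 2).
  by apply: bounded_pastM => //; exact: bounded_pastX.
rewrite (bounded_past_ED P mZ _ k3); last exact: bounded_pastD.
rewrite (bounded_past_ED P mZ k1 k2').
by rewrite (Rintegral_past_X _ k2) ?addr0//; lia.
Qed.

Lemma Rintegral_increment_sum2_le i m f : (n0 <= i)%N -> bp i f ->
  (forall w, 0 <= f w) ->
  \int[P]_w (f w * Sum i m w ^+ 2) <= K ^+ 2 * m%:R * \int[P]_w f w.
Proof.
move=> ni kf f0; elim: m => [|m IH].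
  under eq_Rintegral do rewrite increment_sum0 expr0n mulr0.
  by rewrite Rintegral_cst_probability mulr0 mul0r.
have kf' : bp (i + m) f by apply: bounded_past_widen kf; lia.
rewrite Rintegral_increment_sum2_step// -natr1 mulrDr mulrDl mulr1 lerD//.
exact: Rintegral_past_X2_le.
Qed.

(** The value 0 at n = 0 is the empty increment, so the maximum is nonnegative. It is one-sided;
    absolute values are reached by applying it also to the opposite increments. *)
Fixpoint running_max i n w : R :=
  if n is n'.+1 then Num.max (running_max i n' w) (Sum i n w) else 0.

Lemma running_max_ge0 i n w : 0 <= running_max i n w.
Proof. by elim: n => //= n IH; rewrite le_max IH. Qed.

Lemma increment_sum_le_running_max i n l w :
  (l <= n)%N -> Sum i l w <= running_max i n w.
Proof.
elim: n => [|n IH]; first by rewrite leqn0 => /eqP ->; rewrite increment_sum0.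
by rewrite leq_eqVlt => /predU1P[->|/IH ln]; rewrite le_max ?lexx ?orbT ?ln.
Qed.

Lemma bounded_past_running_max k i n : (i + n <= k)%N -> bp k (running_max i n).
Proof.
elim: n => [|n IH] ink /=; first exact: bounded_past_cst.
apply: bounded_past_max; first by apply: IH; lia.
exact: bounded_past_increment_sum.
Qed.

(* Pathwise form of Doob's inequality: with M the running maximum of S, the
   process M S - M^2 / 2 - sum M dS is nondecreasing. *)
Lemma Rintegral_running_max i n : (n0 <= i)%N ->
  \int[P]_w (running_max i n w ^+ 2) <= 4 * K ^+ 2 * n%:R.
Proof.
move=> ni; have kS k l : (i + l <= k)%N -> bp k (Sum i l).
  by move=> ilk; exact: bounded_past_increment_sum.
have kM k l : (i + l <= k)%N -> bp k (running_max i l).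
  by move=> ilk; exact: bounded_past_running_max.
pose D l w := running_max i l w * Sum i l w - 2^-1 * running_max i l w ^+ 2.
have kD k l : (i + l <= k)%N -> bp k (D l).
  move=> ilk; apply: bounded_pastB.
    by apply: bounded_pastM; [exact: kM|exact: kS].
  by apply: bounded_pastM; [exact: bounded_past_cst|apply/bounded_pastX/kM].
have D0 : 0 <= \int[P]_w D n w.
  elim: n => [|l IH].
    under eq_Rintegral do rewrite /D /= mul0r expr0n mulr0 subr0.
    by rewrite Rintegral_cst_probability.
  have kX : bp (i + l.+1) (fun w => running_max i l w * X (i + l)%N w).
    apply: bounded_pastM; first by apply: kM; lia.
    by apply: bounded_past_X; lia.
  have kDl : bp (i + l.+1) (D l) by apply: kD; lia.
  apply: (@le_trans _ _ (\int[P]_w (D l w + running_max i l w * X (i + l)%N w))).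
    rewrite (bounded_past_ED P mZ kDl kX) Rintegral_past_X ?addr0//; first by lia.
    by apply: kM; lia.
  apply: (bounded_past_le P mZ (bounded_pastD kDl kX)).
    exact: kD.
  (* If the maximum M is unchanged, both sides are equal; if the new sum S exceeds M, they differ by
     (S - M)^2 / 2. *)
  move=> w; rewrite /D /= increment_sumS /Num.max.
  case: ifP => [lt|_]; last by lra.
  have := sqr_ge0 (Sum i l w + X (i + l)%N w - running_max i l w).
  by nra.
have kMn : bp (i + n) (fun w => 4^-1 * running_max i n w ^+ 2).
  by apply: bounded_pastM; [exact: bounded_past_cst|exact/bounded_pastX/kM].
have kM2 : bp (i + n) (fun w => running_max i n w ^+ 2).
  exact/bounded_pastX/kM.
have kSn : bp (i + n) (fun w => Sum i n w ^+ 2) by exact/bounded_pastX/kS.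
have : \int[P]_w D n w <=
    \int[P]_w (Sum i n w ^+ 2 - 4^-1 * running_max i n w ^+ 2).
  apply: (bounded_past_le P mZ (kD _ _ (leqnn _)) (bounded_pastB kSn kMn)).
  (* Since (S - M / 2)^2 >= 0, M S - M^2 / 2 <= S^2 - M^2 / 4; hence E M^2 <= 4 E S^2. *)
  move=> w; rewrite /D.
  by have := sqr_ge0 (Sum i n w - 2^-1 * running_max i n w); lra.
rewrite (bounded_past_EB P mZ kSn kMn) (bounded_past_EZ P mZ _ kM2).
have := Rintegral_increment_sum2_le n ni (bounded_past_cst Z i 1) (fun=> ler01).
under eq_Rintegral do rewrite mul1r.
rewrite Rintegral_cst_probability; lra.
Qed.

Variable v : R.
Hypothesis phi2 : forall l, (n0 <= l)%N -> v <= \int[P]_w (phi l (Z l w) ^+ 2).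

Lemma Rintegral_past_X2_ge l f : (n0 <= l)%N -> bp l f -> (forall w, 0 <= f w) ->
  v * \int[P]_w f w <= \int[P]_w (f w * X l w ^+ 2).
Proof.
move=> nl [lf [M fM]] f0.
rewrite (@past_RintegralM _ _ _ _ _ P Z mZ indepZ l f (fun z => phi l z ^+ 2)
  (M + K ^+ 2))//.
- by rewrite mulrC ler_wpM2l ?phi2//; apply: Rintegral_ge0 => w _.
- exact: measurable_funX.
- by move=> w; rewrite (le_trans (fM w))// lerDl sqr_ge0.
- move=> z; rewrite normrX (@le_trans _ _ (K ^+ 2))//.
    by rewrite lerXn2r ?nnegrE ?K_ge0// phiK.
  by rewrite lerDr; exact: le_trans (normr_ge0 _) (fM point).
Qed.

Lemma Rintegral_increment_sum2_ge i m f : (n0 <= i)%N -> bp i f ->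
  (forall w, 0 <= f w) ->
  v * m%:R * \int[P]_w f w <= \int[P]_w (f w * Sum i m w ^+ 2).
Proof.
move=> ni kf f0; elim: m => [|m IH].
  rewrite mulr0 mul0r; apply: Rintegral_ge0 => w _.
  by rewrite mulr_ge0 ?sqr_ge0.
have kf' : bp (i + m) f by apply: bounded_past_widen kf; lia.
rewrite Rintegral_increment_sum2_step// -natr1 mulrDr mulrDl mulr1 lerD//.
by apply: Rintegral_past_X2_ge => //; lia.
Qed.

(** In the expansion of (S + X)^4 the term 4 S^3 X integrates to zero and the others add at most 8
    K^2 S^2 + 3 K^4. With the second-moment bound this is 8 K^4 m + 3 K^4, within the increment 4
    K^4 (2 m + 1) of the claimed bound. *)
Lemma Rintegral_increment_sum4_le i m f : (n0 <= i)%N -> bp i f ->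
  (forall w, 0 <= f w) ->
  \int[P]_w (f w * Sum i m w ^+ 4) <= 4 * K ^+ 4 * m%:R ^+ 2 * \int[P]_w f w.
Proof.
move=> ni kf f0; have If0 : 0 <= \int[P]_w f w by apply: Rintegral_ge0 => w _.
elim: m => [|m IH].
  under eq_Rintegral do rewrite increment_sum0 expr0n mulr0.
  by rewrite Rintegral_cst_probability expr0n mulr0 mul0r.
have kf' : bp (i + m) f by apply: bounded_past_widen kf; lia.
have kf'' : bp (i + m.+1) f by apply: bounded_past_widen kf; lia.
have kS : bp (i + m) (Sum i m) by apply: bounded_past_increment_sum; lia.
have kS' : bp (i + m.+1) (Sum i m) by apply: bounded_past_increment_sum; lia.
have kS1 : bp (i + m.+1) (Sum i m.+1) by apply: bounded_past_increment_sum; lia.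
have kX : bp (i + m.+1) (X (i + m)%N) by apply: bounded_past_X; lia.
have k1 : bp (i + m.+1) (fun w => f w * Sum i m w ^+ 4).
  by apply: bounded_pastM => //; exact: bounded_pastX.
have k2 : bp (i + m) (fun w => 4 * (f w * Sum i m w ^+ 3)).
  apply: bounded_pastM; first exact: bounded_past_cst.
  by apply: bounded_pastM => //; exact: bounded_pastX.
have k2' : bp (i + m.+1) (fun w => 4 * (f w * Sum i m w ^+ 3) * X (i + m)%N w).
  by apply: bounded_pastM => //; apply: bounded_past_widen k2; lia.
have k3 : bp (i + m.+1) (fun w => f w * Sum i m w ^+ 2).
  by apply: bounded_pastM => //; exact: bounded_pastX.
have k3' : bp (i + m.+1) (fun w => 8 * K ^+ 2 * (f w * Sum i m w ^+ 2)).
  by apply: bounded_pastM => //; exact: bounded_past_cst.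
have k4 : bp (i + m.+1) (fun w => 3 * K ^+ 4 * f w).
  by apply: bounded_pastM => //; exact: bounded_past_cst.
have : \int[P]_w (f w * Sum i m.+1 w ^+ 4) <=
  \int[P]_w (f w * Sum i m w ^+ 4 + 4 * (f w * Sum i m w ^+ 3) * X (i + m)%N w
    + 8 * K ^+ 2 * (f w * Sum i m w ^+ 2) + 3 * K ^+ 4 * f w).
  apply: (bounded_past_le P mZ (k := (i + m.+1)%N)).
  - by apply: bounded_pastM => //; exact: bounded_pastX.
  - by do 3 apply: bounded_pastD => //.
  move=> w; rewrite increment_sumS.
  have : X (i + m)%N w ^+ 2 <= K ^+ 2.
    rewrite -[X in X <= _]real_normK ?num_real//.
    by rewrite lerXn2r ?nnegrE ?K_ge0// phiK.
  rewrite (_ : K ^+ 4 = (K ^+ 2) ^+ 2); last by rewrite -exprM.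
  move: (X _ w) (Sum i m w) (f w) (f0 w) (K ^+ 2) (sqr_ge0 K) => x s y y0 k k0 xk.
  (* The difference of the two sides is 2 x^2 (s - x)^2. *)
  have xxx : 4 * s * x ^+ 3 <= 2 * (x ^+ 2 * s ^+ 2) + 2 * (x ^+ 2) ^+ 2.
    by have := sqr_ge0 (x * (s - x)); nra.
  have xs : x ^+ 2 * s ^+ 2 <= k * s ^+ 2 by rewrite ler_wpM2r ?sqr_ge0.
  have xx : (x ^+ 2) ^+ 2 <= k ^+ 2 by rewrite lerXn2r ?nnegrE ?sqr_ge0.
  rewrite -subr_ge0 (_ : _ - _ = y * (8 * (k * s ^+ 2) + 3 * k ^+ 2
    - (6 * (x ^+ 2 * s ^+ 2) + 4 * s * x ^+ 3 + (x ^+ 2) ^+ 2))); last by ring.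
  by rewrite mulr_ge0//; lra.
rewrite (bounded_past_ED P mZ _ k4); last by do 2 apply: bounded_pastD => //.
rewrite (bounded_past_ED P mZ _ k3'); last exact: bounded_pastD.
rewrite (bounded_past_ED P mZ k1 k2') (Rintegral_past_X _ k2); last by lia.
rewrite (bounded_past_EZ P mZ _ k3) (bounded_past_EZ P mZ _ kf'') addr0.
have := Rintegral_increment_sum2_le m ni kf f0.
rewrite -(natr1 m); move: IH If0 (sqr_ge0 K) (ler0n R m).
rewrite (_ : K ^+ 4 = (K ^+ 2) ^+ 2); last by rewrite -exprM.
move: (\int[P]_w f w) (\int[P]_w (f w * Sum i m w ^+ 4))
  (\int[P]_w (f w * Sum i m.+1 w ^+ 4)) (\int[P]_w (f w * Sum i m w ^+ 2))
  (K ^+ 2) (m%:R).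
move=> e a4 b4 a2 k n A4 e0 k0 n0' A2 B4.
have := mulr_ge0 k0 (eqbRL (subr_ge0 _ _) A2).
by have := mulr_ge0 (sqr_ge0 k) e0; nra.
Qed.

Variables (b a c : R) (m : nat).
(** A product of indicators over consecutive blocks of length m: its first j factors form a weight
    depending on the past of block j. *)
Definition no_jump i j w : R :=
  \prod_(l < j) (1 - (a * c < Sum (i + l * m) m w)%R%:R).

Lemma no_jump_ge0 i j w : 0 <= no_jump i j w.
Proof. by apply: prodr_ge0 => l _; case: (_ < _); rewrite ?subrr ?subr0. Qed.

Lemma no_jumpS i j w : no_jump i j.+1 w =
  no_jump i j w - no_jump i j w * (a * c < Sum (i + j * m) m w)%R%:R.
Proof. by rewrite /no_jump big_ord_recr/= mulrBr mulr1. Qed.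

Lemma bounded_past_no_jump i j : bp (i + j * m) (no_jump i j).
Proof.
elim: j => [|j IH].
  rewrite (_ : no_jump i 0 = fun=> 1); first exact: bounded_past_cst.
  by apply/funext => w; rewrite /no_jump big_ord0.
rewrite (_ : no_jump i j.+1 = fun w => no_jump i j w -
  no_jump i j w * (a * c < Sum (i + j * m) m w)%R%:R); last first.
  by apply/funext => w; exact: no_jumpS.
have IH' : bp (i + j.+1 * m) (no_jump i j) by apply: bounded_past_widen IH; lia.
apply: bounded_pastB => //; apply: bounded_pastM => //.
by apply: bounded_past_gt; apply: bounded_past_increment_sum; lia.
Qed.

Hypotheses (b0 : 0 < b) (a0 : 0 <= a) (c0 : 0 < c) (v0 : 0 <= v).
Hypothesis bKv : 16 * K ^+ 4 <= v * b ^+ 2.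
Hypothesis abv : a ^+ 2 + b * a / 2 <= v / 4.
Hypothesis mc : m%:R = c ^+ 2.

(** A second-moment argument in the style of Paley and Zygmund. The quartic test integrated against
    f has no first-order contribution, a quadratic one of at least v E f, and loses v / 4 E f twice:
    by the fourth moment, thanks to [bKv], and by the constant. So v / 2 E f remains below b^2 times
    the right side. *)
Lemma large_increment i f : (n0 <= i)%N -> bp i f -> (forall w, 0 <= f w) ->
  v / (2 * b ^+ 2) * \int[P]_w f w <=
  \int[P]_w (f w * (a * c < Sum i m w)%R%:R).
Proof.
move=> ni kf f0; have If0 : 0 <= \int[P]_w f w by apply: Rintegral_ge0 => w _.
have kf' : bp (i + m) f by apply: bounded_past_widen kf; lia.
have kS : bp (i + m) (Sum i m) by apply: bounded_past_increment_sum; lia.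
have kJ : bp (i + m) (fun w => f w * (a * c < Sum i m w)%R%:R).
  by apply: bounded_pastM => //; exact: bounded_past_gt.
have k1 : bp (i + m) (fun w => f w * Sum i m w) by exact: bounded_pastM.
have k2 : bp (i + m) (fun w => f w * Sum i m w ^+ 2).
  by apply: bounded_pastM => //; exact: bounded_pastX.
have k4 : bp (i + m) (fun w => f w * Sum i m w ^+ 4).
  by apply: bounded_pastM => //; exact: bounded_pastX.
have kZ (r : R) g : bp (i + m) g -> bp (i + m) (fun w => r * g w).
  by move=> kg; apply: bounded_pastM => //; exact: bounded_past_cst.
have bn0 : b != 0 by rewrite gt_eqF.
have cn0 : c != 0 by rewrite gt_eqF.
have : \int[P]_w (b / (2 * c) * (f w * Sum i m w)
    + c ^- 2 * (f w * Sum i m w ^+ 2)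
    + (- (b ^- 2 * c ^- 4)) * (f w * Sum i m w ^+ 4)
    + (- (v / 4)) * f w)
  <= \int[P]_w (b ^+ 2 * (f w * (a * c < Sum i m w)%R%:R)).
  apply: (bounded_past_le P mZ (k := (i + m)%N)); last first.
  - move=> w; rewrite [leRHS]mulrCA.
    have := ler_wpM2l (f0 w)
      (quartic_test_indicator (Sum i m w) b0 c0 v0 abv).
    by congr (_ <= _); field; rewrite bn0 cn0.
  - exact: kZ.
  - apply: bounded_pastD; last exact: kZ.
    apply: bounded_pastD; last exact: kZ.
    by apply: bounded_pastD; exact: kZ.
rewrite (bounded_past_ED P mZ _ (kZ _ _ kf')); last first.
  by apply: bounded_pastD; [apply: bounded_pastD|]; exact: kZ.
rewrite (bounded_past_ED P mZ _ (kZ _ _ k4)); last first.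
  by apply: bounded_pastD; exact: kZ.
rewrite (bounded_past_ED P mZ (kZ _ _ k1) (kZ _ _ k2)).
rewrite (bounded_past_EZ P mZ _ kf') (bounded_past_EZ P mZ _ k4).
rewrite (bounded_past_EZ P mZ _ k2) (bounded_past_EZ P mZ _ k1).
rewrite (bounded_past_EZ P mZ _ kJ) Rintegral_increment_sum// mulr0 add0r.
have := Rintegral_increment_sum4_le m ni kf f0.
have := Rintegral_increment_sum2_ge m ni kf f0.
rewrite mc.
move: (\int[P]_w f w) If0 (\int[P]_w (f w * Sum i m w ^+ 2))
  (\int[P]_w (f w * Sum i m w ^+ 4))
  (\int[P]_w (f w * (a * c < Sum i m w)%R%:R)) => e e0 e2 e4 j H2 H4 Hj.
have c2 : v * e <= c ^- 2 * e2.
  by rewrite ler_pdivlMl ?exprn_gt0// mulrCA mulrA.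
have c4 : b ^- 2 * c ^- 4 * e4 <= v / 4 * e.
  have : b ^- 2 * c ^- 4 * e4 <= b ^- 2 * c ^- 4 * (4 * K ^+ 4 * (c ^+ 2) ^+ 2 * e).
    by rewrite ler_wpM2l// mulr_ge0// invr_ge0 exprn_ge0// ltW.
  have -> : b ^- 2 * c ^- 4 * (4 * K ^+ 4 * (c ^+ 2) ^+ 2 * e) =
    b ^- 2 * (16 * K ^+ 4) / 4 * e by field; rewrite bn0 cn0.
  move/le_trans; apply; rewrite ler_wpM2r// ler_wpM2r//.
  by rewrite ler_pdivrMl ?exprn_gt0// [leRHS]mulrC.
rewrite -(ler_pM2l (exprn_gt0 2 b0)).
have -> : b ^+ 2 * (v / (2 * b ^+ 2) * e) = v * e / 2 by field.
by lra.
Qed.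

(** Taking the indicator for the earlier blocks as the weight in [large_increment], each new block
    costs a factor 1 - v / (2 b^2). *)
Lemma Rintegral_no_jump i j : (n0 <= i)%N -> v / (2 * b ^+ 2) <= 1 ->
  \int[P]_w no_jump i j w <= (1 - v / (2 * b ^+ 2)) ^+ j.
Proof.
move=> ni p1; elim: j => [|j IH].
  under eq_Rintegral do rewrite /no_jump big_ord0.
  by rewrite Rintegral_cst_probability expr0.
under eq_Rintegral do rewrite no_jumpS.
have k1 : bp (i + j.+1 * m) (no_jump i j).
  by apply: bounded_past_widen (bounded_past_no_jump i j); lia.
rewrite (bounded_past_EB P mZ k1); last first.
  apply: bounded_pastM => //.
  by apply: bounded_past_gt; apply: bounded_past_increment_sum; lia.
have nij : (n0 <= i + j * m)%N by lia.
have := large_increment nij (bounded_past_no_jump i j) (no_jump_ge0 i j).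
move=> H; rewrite exprS.
apply: (@le_trans _ _ ((1 - v / (2 * b ^+ 2)) * \int[P]_w no_jump i j w)).
  by lra.
by rewrite ler_wpM2l// subr_ge0.
Qed.

End Moments.

(** * Almost sure events *)

Section AlmostSure.
Context d (T : measurableType d) (R : realType) (P : probability T R).

Lemma probability_split n (E : set T) (F : nat -> set T) :
  (forall a, measurable (F a)) -> trivIset setT F ->
  (forall w, E w <-> exists2 a, (a < n)%N & F a w) ->
  P E = (\sum_(a < n) P (F a))%E.
Proof.
move=> mF tF EF; rewrite -measure_bigsetU// -bigcup_mkord; congr (P _).
by apply/seteqP; split => w /EF.
Qed.

(** Borel-Cantelli with a geometric majorant. *)
Lemma ae_eventually_not (A : nat -> set T) (C q : R) :
  0 <= C -> 0 <= q < 1 -> (forall k, measurable (A k)) ->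
  (forall k, (P (A k) <= (C * q ^+ k)%:E)%E) ->
  {ae P, forall w, exists k0, forall k, (k0 <= k)%N -> ~ A k w}.
Proof.
move=> C0 /andP[q0 q1] mA PA.
have P0 : P (lim_sup_set A) = 0%E.
  apply: lim_sup_set_cvg0 => //.
  apply: (@le_lt_trans _ _ (\sum_(k <oo) (C * q ^+ k)%:E)%E).
    by apply: lee_nneseries => // k _; exact: PA.
  have cvq : cvgn (series (fun k => C * q ^+ k)).
    by apply: is_cvg_geometric_series; rewrite ger0_norm.
  rewrite (_ : (fun n => _) = EFin \o series (fun k => C * q ^+ k)); last first.
    by apply/funext => n /=; rewrite /series /= sumEFin.
  by rewrite EFin_lim// ltry.
exists (lim_sup_set A); split => //.
  by apply: bigcapT_measurable => n; apply: bigcup_measurable => k _.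
move=> w /= nw n _; apply: contrapT => nAw; apply: nw; exists n => k nk Ak.
by apply: nAw; exists k.
Qed.

(** For each N the union of the A k with k >= N contains events of probability arbitrarily close to
    1, so it is almost sure. Probabilities near 1 thus take the place of independence. *)
Lemma ae_infinitely_often (A : nat -> set T) :
  (forall k, measurable (A k)) ->
  (forall (e : R) N, 0 < e -> exists2 k, (N <= k)%N & ((1 - e)%:E <= P (A k))%E) ->
  {ae P, forall w, forall N, exists2 k, (N <= k)%N & A k w}.
Proof.
move=> mA PA; apply/ae_foralln => N.
pose U := \bigcup_(k in [set k | (N <= k)%N]) A k.
have mU : measurable U by apply: bigcup_measurable.
have PU : P (~` U) = 0%E.
  have fU : P U \is a fin_num by rewrite fin_num_measure.
  rewrite probability_setC// -(fineK fU) -EFinB; congr (_%:E).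
  apply/eqP; rewrite subr_eq0 eq_sym eq_le; apply/andP; split.
    by rewrite -lee_fin fineK// probability_le1.
  apply/ler_addgt0Pr => e e0; have [k Nk Pk] := PA e N e0.
  rewrite -lerBlDr -lee_fin fineK// (le_trans Pk)// le_measure ?inE//.
  by apply: bigcup_sup.
exists (~` U); split => //; first exact: measurableC.
Qed.

End AlmostSure.

(** * Quenched hitting times *)

Section QuenchedWalk.
Context d (T : measurableType d) (R : realType) (Q : probability T R).
Variables (p : nat -> R) (r : nat) (eta : nat -> {RV Q >-> nat}).
Hypothesis walk : quenched_walk p r eta.

Lemma measurable_eta t (B : set nat) : measurable [set v | B (eta t v)].
Proof.
rewrite -[X in measurable X]setTI -[X in _ `&` X]/(eta t @^-1` B).
exact: (measurable_funPT (eta t)).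
Qed.

(** Its complement is the event that n or a site beyond it is visited strictly before time t; this
    replaces a hitting time. *)
Definition confined n t := [set v | forall k, (k < t)%N -> (eta k v < n)%N].

Lemma measurable_confined n t : measurable (confined n t).
Proof.
rewrite (_ : confined n t = \bigcap_(k in `I_t) [set v | (eta k v < n)%N]).
  apply: bigcap_measurableType => k _.
  exact: (measurable_eta k [set y | (y < n)%N]).
by apply/seteqP; split => v /= vn k kt; exact: vn.
Qed.

(* Interpolates between the cylinders of quenched_walk (j = 0) and the event
   confined n t with the position at time t prescribed (j = t). *)
Let mixed n t j (x : nat -> nat) :=
  [set v | (forall k, (k < j)%N -> (eta k v < n)%N) /\
           (forall k, (j <= k <= t)%N -> eta k v = x k)].

Let measurable_mixed n t j x : measurable (mixed n t j x).
Proof.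
rewrite (_ : mixed n t j x = confined n j `&`
  \bigcap_(k in [set k | (j <= k <= t)%N]) [set v | eta k v = x k]).
  apply: measurableI; first exact: measurable_confined.
  apply: bigcap_measurableType => k _.
  exact: (measurable_eta k [set y | y = x k]).
by apply/seteqP; split => v [].
Qed.

Let mixedS n t j x v : (j <= t)%N -> mixed n t j.+1 x v <->
  exists2 a, (a < n)%N & mixed n t j (fun k => if k == j then a else x k) v.
Proof.
move=> jt; split => [[vn vx]|[a an [vn vx]]].
  exists (eta j v); first exact: vn.
  split; first by move=> k kj; apply: vn; lia.
  move=> k jkt; case: eqP => [->//|/eqP kj]; apply: vx; lia.
split.
  move=> k; rewrite ltnS leq_eqVlt => /predU1P[->|]; last exact: vn.
  by have := vx j; rewrite eqxx leqnn jt => ->.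
by move=> k jkt; have := vx k; rewrite ifF; [apply|]; lia.
Qed.

Let mixed_disj n t j x : (j <= t)%N ->
  trivIset setT (fun a : nat => mixed n t j (fun k => if k == j then a else x k)).
Proof.
move=> jt a b _ _ [v [[_ va] [_ vb]]].
by have := va j; have := vb j; rewrite eqxx leqnn jt /= => <-// <-.
Qed.

Let mixed_markov n t j x y : (j <= t)%N ->
  Q (mixed n t j x `&` [set v | eta t.+1 v = y]) =
  (Q (mixed n t j x) * (trans p (x t) y)%:E)%E.
Proof.
elim: j x => [|j IH] x jt.
  rewrite (_ : mixed n t 0 x = [set v | forall k, (k <= t)%N -> eta k v = x k]).
    exact: walk.2.
  by apply/seteqP; split => v => [[_ vx] k kt|vx]; [exact: vx|split].
have disj := @mixed_disj n t j x (ltnW jt).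
have mm (a : nat) := @measurable_mixed n t j (fun k => if k == j then a else x k).
have meta : measurable [set v | eta t.+1 v = y].
  exact: (measurable_eta t.+1 [set z | z = y]).
(* Summing over the value a < n at time j turns a prescribed position into the constraint of staying
   below n. As j < t, the position at time t, and so the transition factor, is the same in every
   term. *)
rewrite (@probability_split _ _ _ Q n (mixed n t j.+1 x) _ mm disj); last first.
  by move=> v; apply: mixedS; exact: ltnW.
rewrite (@probability_split _ _ _ Q n _ (fun a => [set v | eta t.+1 v = y] `&`
  mixed n t j (fun k => if k == j then a else x k))); last 3 first.
- by move=> a; exact: measurableI.
- exact: trivIset_setIl.
- move=> v; split => [[/(mixedS _ _ _ (ltnW jt))[a an va] vy]|[a an [vy va]]].
    by exists a.
  by split => //; apply/(mixedS _ _ _ (ltnW jt)); exists a.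
rewrite ge0_sume_distrl; last by move=> a _; exact: measure_ge0.
apply: eq_bigr => a _; rewrite setIC IH; last exact: ltnW.
by rewrite ifF//; lia.
Qed.

(** For y < n, the law at time t of the walk killed on reaching n. Its total mass over y < n is the
    survival probability. *)
Definition occupation n t y : R :=
  fine (Q (confined n t `&` [set v | eta t v = y])).

Lemma occupation_ge0 n t y : 0 <= occupation n t y.
Proof. exact/fine_ge0/measure_ge0. Qed.

Lemma occupation0 n y : occupation n 0 y = (y == r)%:R.
Proof.
rewrite /occupation (_ : confined n 0 = setT); last first.
  by apply/seteqP; split.
rewrite setTI; case: eqP => [->|/eqP yr]; first by rewrite walk.1.
have m (z : nat) : measurable [set v | eta 0%N v = z].
  exact: (measurable_eta 0 [set y | y = z]).
have : (Q [set v | eta 0%N v = y] <= 0)%E.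
  have <- : (1 - Q [set v | eta 0%N v = r])%E = 0%E by rewrite walk.1 subee.
  rewrite -probability_setC// le_measure ?inE//; first exact: measurableC.
  by move=> v /= -> /eqP; exact/negP.
by rewrite measure_le0 => /eqP ->.
Qed.

Lemma occupationS n t y : (y < n)%N ->
  occupation n t.+1 y = \sum_(x < n) occupation n t x * trans p x y.
Proof.
move=> yn; have m1 (z : nat) : measurable (confined n t `&` [set v | eta t v = z]).
  apply: measurableI; first exact: measurable_confined.
  exact: (measurable_eta t [set y | y = z]).
have m2 : measurable [set v | eta t.+1 v = y].
  exact: (measurable_eta t.+1 [set z | z = y]).
rewrite /occupation (@probability_split _ _ _ Q n _ (fun x =>
    confined n t `&` [set v | eta t v = x] `&` [set v | eta t.+1 v = y])).
- rewrite -sum_fine; last by move=> x _; rewrite fin_num_measure//; exact: measurableI.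
  apply: eq_bigr => x _.
  rewrite (_ : confined n t `&` [set v | eta t v = x] =
    mixed n t t (fun=> x : nat)); last first.
    apply/seteqP; split => v /= [vn vx]; split => //.
      by move=> k; rewrite -eqn_leq => /eqP <-.
    by apply: vx; rewrite leqnn.
  by rewrite mixed_markov// fineM// fin_num_measure.
- by move=> x; exact: measurableI.
- by move=> a b _ _ [v [[[_ /= va] _] [[_ /= vb] _]]]; rewrite -va -vb.
move=> v; split => [[/= vn vy]|[x /= xn [[vn vx] vy]]].
  exists (eta t v); first exact: vn.
  by split => //; split => // k kt; apply: vn; lia.
split => // k.
by rewrite ltnS leq_eqVlt => /predU1P[->|]; [rewrite vx|exact: vn].
Qed.

Lemma probability_confined n t :
  Q (confined n t.+1) = (\sum_(y < n) occupation n t y)%:E.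
Proof.
have m1 (z : nat) : measurable (confined n t `&` [set v | eta t v = z]).
  apply: measurableI; first exact: measurable_confined.
  exact: (measurable_eta t [set y | y = z]).
rewrite (@probability_split _ _ _ Q n _ (fun x =>
    confined n t `&` [set v | eta t v = x])) => //.
- by rewrite -sumEFin; apply: eq_bigr => x _; rewrite fineK// fin_num_measure.
- by move=> a b _ _ [v [[_ /= va] [_ /= vb]]]; rewrite -va -vb.
move=> v; split => [vn|[x /= xn [vn vx]] k].
  exists (eta t v); first exact: vn.
  by split => // k kt; apply: vn; lia.
by rewrite ltnS leq_eqVlt => /predU1P[->|]; [rewrite vx|exact: vn].
Qed.

Hypothesis p01 : forall n, 0 < p n < 1.

(** As p is the probability of a step towards 0, a rise of the potential pushes the walk back. *)
Definition potential k : R := \sum_(l < k) ln (p l.+1 / (1 - p l.+1)).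

Lemma expR_potentialS k :
  expR (potential k.+1) = expR (potential k) * (p k.+1 / (1 - p k.+1)).
Proof.
have /andP[p0 p1] := p01 k.+1.
rewrite /potential big_ord_recr expRD lnK// posrE divr_gt0//= subr_gt0.
exact: p1.
Qed.

(** The convention 0.-1 = 0 encodes the holding at the origin, so one formula serves all sites; f n
    = 0 accounts for the killing at n. *)
Lemma sum_trans n x (f : nat -> R) : (x < n)%N -> f n = 0 ->
  \sum_(y < n) trans p x y * f y =
  p x * f x.-1 + (1 - p x) * f x.+1.
Proof.
move=> xn fn; have -> : \sum_(y < n) trans p x y * f y =
    \sum_(y < n.+1) trans p x y * f y.
  by rewrite big_ord_recr/= fn mulr0 addr0.
have xn0 : (x.-1 < n.+1)%N by lia.
have xn1 : (x.+1 < n.+1)%N by lia.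
rewrite (bigD1 (Ordinal xn0)) //= (bigD1 (Ordinal xn1)) /=; last first.
  by rewrite -val_eqE /=; lia.
rewrite big1 ?addr0; last first.
  move=> y /andP[]; rewrite -!val_eqE /= => y0 y1.
  by case: x xn xn0 xn1 y0 y1 => [|x] _ _ _ /= /negbTE-> /negbTE->; rewrite mul0r.
congr (_ * _ + _ * _).
  by case: x {xn xn0 xn1} => [|x] //=; rewrite eqxx.
by case: x {xn xn0 xn1} => [|x] //=; rewrite ifF ?eqxx//; lia.
Qed.

Lemma sum_occupationS n t (f : nat -> R) : f n = 0 ->
  \sum_(y < n) occupation n t.+1 y * f y =
  \sum_(x < n) occupation n t x * (p x * f x.-1 + (1 - p x) * f x.+1).
Proof.
move=> fn; under eq_bigr => y _ do rewrite occupationS// mulr_suml.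
rewrite exchange_big /=; apply: eq_bigr => x _.
rewrite -(sum_trans (ltn_ord x) fn) mulr_sumr.
by apply: eq_bigr => y _; rewrite mulrA.
Qed.

Lemma sum_occupation0 n (f : nat -> R) : (r < n)%N ->
  \sum_(y < n) occupation n 0 y * f y = f r.
Proof.
move=> rn; rewrite (bigD1 (Ordinal rn)) //= occupation0 eqxx mul1r.
rewrite big1 ?addr0// => y; rewrite -val_eqE /= => /negbTE yr.
by rewrite occupation0 yr mul0r.
Qed.

Lemma sum_occupation_le1 n t : \sum_(y < n) occupation n t y <= 1.
Proof.
rewrite -lee_fin -probability_confined probability_le1//.
exact: measurable_confined.
Qed.

Section Barrier.
Variables (i j : nat).
Hypotheses (ri : (r <= i)%N) (ij : (i <= j)%N).

(* h is harmonic for the walk at every site but i. *)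
Let e l : R := if (i <= l)%N then expR (potential l - potential i) else 0.
Let h x : R := \sum_(l < x) e l.

Let e_ge0 l : 0 <= e l.
Proof. by rewrite /e; case: ifP => // _; exact: expR_ge0. Qed.

(** The increment [e] satisfies (1 - p x) e x = p x e (x - 1) for x > i and vanishes below i; at i
    itself e = 1, so the drift is at most 1 there. *)
Let h_step x : p x * h x.-1 + (1 - p x) * h x.+1 <= h x + 1.
Proof.
have /andP[p0 p1] := p01 x.
have -> : h x.+1 = h x + e x by rewrite /h big_ord_recr.
case: x p0 p1 => [|x] p0 p1 /=.
  have : e 0 <= 1.
    rewrite /e; case: ifP => // i0.
    by rewrite (_ : i = 0%N) ?subrr ?expR0//; lia.
  by have := e_ge0 0; nra.
have -> : h x.+1 = h x + e x by rewrite /h big_ord_recr.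
suff : (1 - p x.+1) * e x.+1 <= p x.+1 * e x + 1 by lra.
rewrite /e; case: (ltngtP i x.+1) => [ix|ix|ix].
- rewrite (_ : (i <= x)%N = true)// !expRB expR_potentialS.
  rewrite (_ : (1 - p x.+1) * _ = p x.+1 * (expR (potential x) / expR (potential i))).
    by rewrite lerDl.
  by field; rewrite gt_eqF ?expR_gt0 ?subr_eq0 /= ?gt_eqF.
- by rewrite mulr0 addr_ge0// mulr_ge0 ?(ltW p0)//; case: ifP => // _; exact: expR_ge0.
- rewrite -ix subrr expR0 mulr1 ifF ?mulr0; last by lia.
  by rewrite add0r; move: p0; rewrite ix; lra.
Qed.

(** The mean of g = h n - h under the killed law starts at h n, because h vanishes up to i, and
    loses at most 1 per step. It is also at most h n times the survival probability, so h n times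
    the crossing probability is at most t, while h n >= exp (V j - V i). *)
Lemma confined_barrier t :
  (Q (~` confined j.+1 t.+1) <=
   (t%:R * expR (potential i - potential j))%:E)%E.
Proof.
(* The level j + 1 makes h n include the term [e j], which carries the height of the barrier. *)
set n := j.+1; pose g x := h n - h x.
have gn : g n = 0 by rewrite /g subrr.
have hr : h r = 0.
  by apply: big1 => l _; rewrite /e ifF//; have := ltn_ord l; lia.
have G0 : 0 < h n.
  rewrite /h big_ord_recr /= ltr_wpDl//; first exact: sumr_ge0.
  by rewrite /e ij expR_gt0.
have Gn : expR (potential j - potential i) <= h n.
  rewrite /h big_ord_recr /= {2}/e ij lerDr; exact: sumr_ge0.
have M_ge : g r - t%:R <= \sum_(y < n) occupation n t y * g y.
  elim: t => [|t IH].
    by rewrite sum_occupation0 ?subr0//; rewrite /n; lia.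
  rewrite sum_occupationS//.
  apply: (@le_trans _ _ (\sum_(x < n) (occupation n t x * g x - occupation n t x))).
    rewrite sumrB -natr1; have := sum_occupation_le1 n t; lra.
  apply: ler_sum => x _; rewrite -[X in _ - X]mulr1 -mulrBr.
  rewrite ler_wpM2l ?occupation_ge0//.
  by have := h_step x; rewrite /g; lra.
have M_le : \sum_(y < n) occupation n t y * g y <=
    h n * \sum_(y < n) occupation n t y.
  rewrite mulr_sumr; apply: ler_sum => y _.
  rewrite mulrC ler_wpM2r ?occupation_ge0// /g lerBlDr lerDl.
  by apply: sumr_ge0.
rewrite probability_setC; last exact: measurable_confined.
rewrite probability_confined -EFinB lee_fin.
set s := \sum_(y < n) occupation n t y in M_le *.
have st : h n * (1 - s) <= t%:R by move: M_ge; rewrite /g hr; lra.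
rewrite -[potential i - potential j]opprB expRN ler_pdivlMr ?expR_gt0// mulrC.
apply: le_trans st; rewrite ler_wpM2r// subr_ge0; exact: sum_occupation_le1.
Qed.

End Barrier.

(* The mean time the walk takes from k to k + 1. *)
Fixpoint crossing_time k : R :=
  if k is k'.+1 then (1 - p k)^-1 + p k / (1 - p k) * crossing_time k'
  else (1 - p 0)^-1.

(** The mean hitting time u of n is a sum of crossing times and drops by exactly 1 per step in mean,
    so the survival probabilities sum to at most u r. They decrease in time, which gives Markov's
    bound u r / t. *)
Lemma confined_crossing (kappa b : R) n t : 0 < kappa -> (r < n)%N -> (0 < t)%N ->
  (forall k, kappa <= 1 - p k) ->
  (forall k, (k < n)%N -> `|potential k| <= b) ->
  (Q (confined n t) <= (n%:R ^+ 2 * (expR (2 * b) / kappa) / t%:R)%:E)%E.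
Proof.
move=> k0 rn t0 pk Vb.
have b0 : 0 <= b by apply: le_trans (Vb _ rn).
have q_le k : (1 - p k)^-1 <= kappa^-1 by rewrite lef_pV2 ?posrE// (lt_le_trans k0).
have ct_ge0 k : 0 <= crossing_time k.
  have /andP[p0 p1] := p01 0.
  elim: k => [|k IH] /=; first by rewrite invr_ge0; lra.
  have /andP[pk0 pk1] := p01 k.+1.
  by rewrite addr_ge0 ?invr_ge0 ?mulr_ge0 ?invr_ge0 ?subr_ge0// ltW.
(* Unrolled, the crossing time is a sum over l <= k of exp (V k - V l) / (1 - p l), where -V l <=
   b. *)
have ct_le k : (k < n)%N ->
    crossing_time k <= expR (potential k) * (k.+1%:R * (expR b / kappa)).
  elim: k => [|k IH] kn /=.
    rewrite /potential big_ord0 expR0 !mul1r (le_trans (q_le 0%N))//.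
    rewrite ler_peMl ?invr_ge0 ?(ltW k0)//.
    by rewrite -expR0 ler_expR.
  have /andP[pk0 pk1] := p01 k.+1.
  have ik : 0 <= kappa^-1 by rewrite invr_ge0 ltW.
  have rho0 : 0 <= p k.+1 / (1 - p k.+1) by rewrite divr_ge0// ltW// subr_gt0.
  have h1 : (1 - p k.+1)^-1 <= expR (potential k.+1) * (expR b / kappa).
    rewrite mulrA -expRD (le_trans (q_le _))// ler_peMl//.
    by rewrite -expR0 ler_expR; have := Vb _ kn; rewrite ler_norml; lra.
  have := ler_wpM2l rho0 (IH (ltnW kn)).
  rewrite expR_potentialS in h1 *.
  rewrite -[k.+2%:R]natr1 mulrDl mul1r mulrDr.
  by rewrite mulrCA mulrA; lra.
pose u x := \sum_(x <= k < n) crossing_time k.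
have un : u n = 0 by rewrite /u big_geq.
have uS x : (x < n)%N -> u x = crossing_time x + u x.+1.
  by move=> xn; rewrite /u big_ltn.
have u_step x : (x < n)%N -> p x * u x.-1 + (1 - p x) * u x.+1 = u x - 1.
  move=> xn; have /andP[p0 p1] := p01 x.
  have q0 : 1 - p x != 0 by rewrite subr_eq0 gt_eqF.
  case: x xn p0 p1 q0 => [|x] xn p0 p1 q0 /=.
    by rewrite (uS 0%N xn) /=; field.
  by rewrite (uS x (ltnW xn)) (uS x.+1 xn) /=; field.
have u0 x : 0 <= u x by apply: sumr_ge0 => k _; exact: ct_ge0.
pose M s := \sum_(y < n) occupation n s y * u y.
have MS s : M s.+1 = M s - \sum_(y < n) occupation n s y.
  rewrite /M sum_occupationS// -sumrB; apply: eq_bigr => x _.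
  by rewrite u_step// mulrBr mulr1.
have M0 s : 0 <= M s.
  by apply: sumr_ge0 => y _; rewrite mulr_ge0 ?occupation_ge0.
have Msum s : \sum_(l < s) \sum_(y < n) occupation n l y = u r - M s.
  elim: s => [|s IH]; first by rewrite big_ord0 /M sum_occupation0// subrr.
  by rewrite big_ord_recr /= IH MS; ring.
have conf_mono s : (s < t)%N ->
    (Q (confined n t) <= (\sum_(y < n) occupation n s y)%:E)%E.
  move=> st; rewrite -probability_confined le_measure ?inE//.
  - exact: measurable_confined.
  - exact: measurable_confined.
  - by move=> v vn k ks; apply: vn; lia.
have u_le : u r <= n%:R ^+ 2 * (expR (2 * b) / kappa).
  (* One b comes from V k and the other from -V l. *)
  have ub k : (k < n)%N -> crossing_time k <= n%:R * (expR (2 * b) / kappa).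
    move=> kn; rewrite (le_trans (ct_le k kn))//.
    rewrite mulrCA ler_pM ?ler0n//.
    - by rewrite mulr_ge0 ?expR_ge0// divr_ge0 ?expR_ge0 ?ltW.
    - by rewrite ler_nat.
    rewrite mulrA ler_wpM2r ?invr_ge0 ?(ltW k0)//.
    rewrite -expRD ler_expR; have := Vb _ kn; rewrite ler_norml; lra.
  rewrite expr2 -mulrA /u big_nat_cond.
  apply: (@le_trans _ _ (\sum_(r <= k < n | (r <= k < n)%N && true)
    (n%:R * (expR (2 * b) / kappa)))).
    by apply: ler_sum => k /andP[/andP[_ kn] _]; exact: ub.
  rewrite -big_nat_cond sumr_const_nat -[leLHS]mulr_natl ler_wpM2r ?ler_nat ?leq_subr//.
  by rewrite mulr_ge0 ?ler0n// divr_ge0 ?expR_ge0// ltW.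
have fQ : Q (confined n t) \is a fin_num.
  by rewrite fin_num_measure//; exact: measurable_confined.
rewrite -(fineK fQ) lee_fin ler_pdivlMr ?ltr0n//.
apply: le_trans u_le; rewrite mulr_natr.
apply: (@le_trans _ _ (\sum_(l < t) \sum_(y < n) occupation n l y)); last first.
  by rewrite Msum gerBl.
rewrite -[X in _ *+ X]card_ord -sumr_const; apply: ler_sum => l _.
by rewrite -lee_fin fineK//; exact: conf_mono.
Qed.

End QuenchedWalk.

(** * Asymptotic rates *)

Section QuenchedLimits.
Context (R : realType).

Lemma infinite_set_unbounded (A : set nat) :
  (forall N, exists2 t, (N <= t)%N & A t) -> infinite_set A.
Proof.
move=> unbA /finite_seqP[s As].
have [t st] := unbA (\max_(i <- s) i).+1; rewrite As /= => ts.
by have := @leq_bigmax_seq _ s xpredT (fun i : nat => i) t ts isT; rewrite leqNgt st.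
Qed.

Lemma exp2_gt (k : nat) : k%:R < 2 ^+ k :> R.
Proof. by rewrite -natrX ltr_nat ltn_expl. Qed.

Lemma ln_natr_large (M : R) : exists m0, forall m, (m0 <= m)%N -> M <= ln m%:R.
Proof.
exists (Num.bound (expR M)).+1 => m mm.
have h : expR M < m%:R.
  apply: (lt_trans (archi_boundP (expR_ge0 M))).
  by rewrite ltr_nat; lia.
rewrite -[M]expRK ler_ln ?posrE ?expR_gt0 ?(ltW h)//.
exact: lt_trans (expR_gt0 M) h.
Qed.

(** Take the least k with log t <= a 2^k / 2. By minimality 2^k < 4 log t / a, hence 4^k <= 16 (log
    t)^2 / a^2 and k <= (2 / log 2) log log t for large t. *)
Lemma upper_rate (a eps : R) (n0 k1 : nat) : 0 < a -> 0 < eps ->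
  exists t0, forall t, (t0 <= t)%N ->
    exists2 k, (k1 <= k)%N & t%:R <= expR (a * 2 ^+ k / 2) /\
      (n0 + k * 4 ^ k)%:R <= ln (t%:R) ^+ 2 * ln (ln t%:R) `^ (2 + eps) :> R.
Proof.
move=> a0 eps0.
have l2 : 0 < ln 2 :> R by rewrite ln_gt0// ltr1n.
(* 64 / (a^2 log 2) is the product of the constants 2, 2 / log 2 and 16 / a^2 met below; the added 1
   ensures log log t >= 1. *)
pose C : R := 64 / (a ^+ 2 * ln 2) + 1.
have C1 : 1 <= C.
  by rewrite /C lerDr divr_ge0// mulr_ge0 ?sqr_ge0// ltW.
(* Any k > K0 gives both log log t >= C and log log t >= k log 2 / 2, and also n0 <= k and k1 <=
   k. *)
have [K0 K0C K0n] : exists2 K0 : nat,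
    2 * (`|ln (a / 4)| + C) / ln 2 <= K0%:R & (n0 + k1 < K0)%N.
  exists (Num.bound (2 * (`|ln (a / 4)| + C) / ln 2) + n0 + k1 + 1)%N; last by lia.
  apply: (@le_trans _ _ (Num.bound (2 * (`|ln (a / 4)| + C) / ln 2))%:R).
    apply/ltW/archi_boundP; rewrite divr_ge0 ?(ltW l2)// mulr_ge0// addr_ge0//.
    exact: le_trans ler01 C1.
  by rewrite ler_nat; lia.
exists (Num.bound (expR (a * 2 ^+ K0 / 2))).+1 => t tt.
have tK : expR (a * 2 ^+ K0 / 2) < t%:R.
  apply: (lt_trans (archi_boundP (expR_ge0 _))).
  by rewrite ltr_nat.
have t0 : 0 < t%:R :> R by apply: lt_trans tK; exact: expR_gt0.
have xK : a * 2 ^+ K0 / 2 < ln t%:R.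
  by rewrite -[ltLHS]expRK ltr_ln ?posrE ?expR_gt0.
have half (y : R) : a * (2 * y) / 4 <= a * y / 2 by lra.
have ex : exists k, ln t%:R <= a * 2 ^+ k / 2.
  exists (Num.bound (2 * ln t%:R / a)).
  have h0 : 0 <= 2 * ln t%:R / a.
    rewrite divr_ge0 ?(ltW a0)// mulr_ge0//.
    by rewrite (le_trans _ (ltW xK))// !mulr_ge0 ?exprn_ge0// ?ltW// invr_ge0.
  have h1 := lt_trans (archi_boundP h0) (exp2_gt _).
  move: h1; rewrite ltr_pdivrMr// => /ltW h1.
  by rewrite ler_pdivlMr// mulrC (le_trans h1)// mulrC.
have [k tk kmin] := ex_minnP ex.
have Kk : (K0 < k)%N.
  rewrite ltnNge; apply/negP => kK.
  have := lt_le_trans xK tk; apply/negP; rewrite -leNgt.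
  by rewrite ler_pM2r ?invr_gt0// ler_pM2l// ler_weXn2l// ler1n.
have tk' : a * 2 ^+ k / 4 < ln t%:R.
  rewrite ltNge; apply/negP => h.
  have : (k <= k.-1)%N.
    apply: kmin; apply: (le_trans h).
    by rewrite -{1}(prednK (leq_ltn_trans (leq0n _) Kk)) exprS half.
  by rewrite leqNgt ltn_predL (leq_ltn_trans _ Kk).
exists k; first exact: leq_trans (leq_addl _ _) (ltnW (ltn_trans K0n Kk)).
split; first by rewrite -[leLHS]lnK ?posrE// ler_expR.
set x := ln t%:R in tk tk' xK *.
have p2 : 0 < 2 ^+ k :> R by rewrite exprn_gt0.
have x0 : 0 < x by apply: lt_trans tk'; rewrite divr_gt0// mulr_gt0.
have kk : 2 * (`|ln (a / 4)| + C) / ln 2 <= k%:R.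
  by apply: (le_trans K0C); rewrite ler_nat ltnW.
have lnx : ln (a / 4) + k%:R * ln 2 <= ln x.
  rewrite mulr_natl -lnXn// -lnM ?posrE ?divr_gt0//.
  rewrite ler_ln ?posrE ?mulr_gt0 ?divr_gt0//.
  by rewrite mulrAC ltW.
have kk2 : `|ln (a / 4)| + C <= k%:R * ln 2 / 2.
  by move: kk; rewrite ler_pdivrMr//; lra.
have xC : C <= ln x.
  have : - ln (a/4) <= `|ln (a / 4)| by rewrite -normrN ler_norm.
  have := normr_ge0 (ln (a / 4)); lra.
have xk : k%:R <= 2 / ln 2 * ln x.
  rewrite mulrAC ler_pdivlMr//.
  have : - ln (a/4) <= `|ln (a / 4)| by rewrite -normrN ler_norm.
  by lra.
have L1 : 1 <= ln x by exact: le_trans C1 xC.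
have nk : (n0 + k * 4 ^ k)%:R <= 2 * k%:R * 4 ^+ k :> R.
  rewrite -[4 ^+ k]natrX -[2 * k%:R]natrM -natrM ler_nat.
  rewrite -mulnA mul2n -addnn leq_add2r.
  apply: leq_trans (leq_pmulr k (expn_gt0 4 k)).
  exact: leq_trans (leq_addr _ _) (ltnW (ltn_trans K0n Kk)).
have x4 : 4 ^+ k <= 16 / a ^+ 2 * x ^+ 2.
  have : (a * 2 ^+ k / 4) ^+ 2 <= x ^+ 2.
    by rewrite lerXn2r ?nnegrE ?(ltW tk')// ltW// divr_gt0// mulr_gt0.
  rewrite (_ : (a * 2 ^+ k / 4) ^+ 2 = a ^+ 2 / 16 * 4 ^+ k); last first.
    rewrite (_ : 4 = 2 ^+ 2 :> R); last by rewrite expr2; ring.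
    by rewrite -exprM mulnC exprM; field.
  move=> h; rewrite mulrAC ler_pdivlMr ?exprn_gt0//; lra.
apply: (le_trans nk).
(* The bound holds with one power of log log t and the constant C, and C <= log log t turns it into
   the second power. *)
apply: (@le_trans _ _ (x ^+ 2 * (C * ln x))).
  apply: (@le_trans _ _ (2 * (2 / ln 2 * ln x) * (16 / a ^+ 2 * x ^+ 2))).
    rewrite ler_pM// ?exprn_ge0// ?mulr_ge0//.
    by rewrite ler_wpM2l.
  rewrite (_ : 2 * (2 / ln 2 * ln x) * (16 / a ^+ 2 * x ^+ 2) =
    x ^+ 2 * (64 / (a ^+ 2 * ln 2) * ln x)); last first.
    by field; rewrite !gt_eqF.
  rewrite ler_wpM2l ?sqr_ge0// ler_wpM2r//; first exact: le_trans ler01 L1.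
  by rewrite /C lerDl.
rewrite ler_wpM2l ?sqr_ge0//.
apply: (@le_trans _ _ (ln x `^ 2%:R)).
  rewrite powR_mulrn; last exact: le_trans ler01 L1.
  by rewrite expr2 ler_wpM2r// (le_trans ler01).
by apply: ler_powR => //; rewrite lerDl ltW.
Qed.

Context d (T : measurableType d) (Q : probability T R).
Variables (p : nat -> R) (r : nat) (eta : nat -> {RV Q >-> nat}).
Hypothesis walk : quenched_walk p r eta.
Hypothesis p01 : forall n, 0 < p n < 1.

(** Within exp (a 2^k / 2) steps the k-th barrier is crossed with probability at most exp (-a 2^k /
    2), which is dominated by a geometric sequence. *)
Lemma quenched_upper (a : R) (n0 k0 : nat) : 0 < a ->
  (forall k, (k0 <= k)%N -> exists i j, [/\ (r <= i)%N, (i <= j)%N,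
     (j <= n0 + k * 4 ^ k)%N & a * 2 ^+ k <= potential p j - potential p i]) ->
  forall eps : R, 0 < eps ->
  {ae Q, forall v, \forall t \near \oo,
    0 <= (eta t v)%:R / ln (t%:R : R) ^+ 2 <= ln (ln (t%:R : R)) `^ (2 + eps)}.
Proof.
move=> a0 jump eps eps0.
pose N k := (n0 + k * 4 ^ k)%N.
pose tm k := Num.truncn (expR (a * 2 ^+ k / 2)).
(* The shift by k0 supplies a barrier for every index; the two successors make both the level N and
   the time tm inclusive. *)
pose A k := ~` confined eta (N (k + k0)%N).+1 (tm (k + k0)%N).+1.
have mA k : measurable (A k) by apply: measurableC; exact: measurable_confined.
have PA k : (Q (A k) <= (1 * expR (- (a / 2)) ^+ k)%:E)%E.
  have [i [j [ri ij jN Vij]]] := jump (k + k0)%N (leq_addl _ _).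
  apply: (@le_trans _ _ (Q (~` confined eta j.+1 (tm (k + k0)%N).+1))).
    apply: le_measure; rewrite ?inE//.
      by apply: measurableC; exact: measurable_confined.
    move=> v /= nv vj; apply: nv => l lt; have := vj l lt.
    by rewrite /N; lia.
  apply: (le_trans (confined_barrier walk p01 ri ij _)).
  rewrite lee_fin mul1r -expRM_natl.
  apply: (@le_trans _ _ (expR (a * 2 ^+ (k + k0) / 2) * expR (- (a * 2 ^+ (k + k0))))).
    apply: ler_pM => //.
      by have /truncn_itv/andP[] : 0 <= expR (a * 2 ^+ (k + k0) / 2) by exact: expR_ge0.
    by rewrite ler_expR; lra.
  rewrite -expRD ler_expR.
  have := exp2_gt (k + k0); rewrite natrD.
  have := ler0n R k0; have := ler0n R k; set y := 2 ^+ _ => k'0 k0'0 ky.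
  have : a * k%:R <= a * y by rewrite ler_wpM2l ?(ltW a0)//; lra.
  by rewrite -mulr_natl; lra.
have := ae_eventually_not ler01 _ mA PA.
have -> : 0 <= expR (- (a / 2)) < 1.
  by rewrite expR_ge0 /= -expR0 ltr_expR oppr_lt0 divr_gt0.
move=> /(_ isT); apply: filterS => v [k1 vk].
have [t0 tP] := upper_rate n0 (k1 + k0) a0 eps0.
exists (maxn t0 3) => // t /= tt; have [k kk [tk Nk]] := tP t ltac:(lia).
have x0 : 0 < ln (t%:R : R) by rewrite ln_gt0// ltr1n; lia.
rewrite divr_ge0 ?ler0n ?sqr_ge0//= ler_pdivrMr ?exprn_gt0//.
apply: le_trans (le_trans Nk _); last by rewrite mulrC.
rewrite ler_nat.
have := vk (k - k0)%N ltac:(lia); rewrite /A subnK; last by lia.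
move=> /contrapT/(_ t); rewrite ltnS; apply.
by rewrite /tm truncn_ge_nat ?expR_ge0.
Qed.

(** From exp y >= (y / 6)^6 at y = 2^m the exponential is at least 64^m / 6^6, which beats 16^m by a
    factor 4^m. *)
Lemma exists_exp_small (kappa e : R) : 0 < kappa -> 0 < e ->
  exists m0, forall m, (m0 <= m)%N ->
    16 ^+ m / kappa * expR (- 2 ^+ m) <= e.
Proof.
move=> k0 e0.
pose M : R := 6 ^+ 6 / (kappa * e).
have M0 : 0 < M by rewrite divr_gt0 ?mulr_gt0// exprn_gt0.
exists (Num.bound M) => m mm.
have p2 : 0 < 2 ^+ m :> R by rewrite exprn_gt0.
have Mm : M <= 4 ^+ m.
  apply/ltW/(lt_le_trans (archi_boundP (ltW M0))).
  apply: (@le_trans _ _ (2 ^+ m)).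
    by apply: le_trans (ltW (exp2_gt m)); rewrite ler_nat.
  by rewrite lerXn2r ?nnegrE// ler_nat.
have e6 : (2 ^+ m / 6) ^+ 6 <= expR (2 ^+ m) :> R.
  have -> : expR (2 ^+ m) = expR (2 ^+ m / 6) ^+ 6 :> R.
    by rewrite -expRM_natl -mulr_natl; congr expR; field.
  rewrite lerXn2r ?nnegrE ?expR_ge0// ?divr_ge0 ?(ltW p2)//.
  by apply: le_trans (expR_ge1Dx _); rewrite lerDr.
rewrite expRN ler_pdivrMr ?expR_gt0//.
apply: (@le_trans _ _ (e * (2 ^+ m / 6) ^+ 6)); last by rewrite ler_wpM2l// ltW.
rewrite ler_pdivrMr//.
have -> : e * (2 ^+ m / 6) ^+ 6 * kappa = 16 ^+ m * (4 ^+ m / M).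
  rewrite (_ : 16 = 2 ^+ 4 :> R); last by rewrite !exprS expr0; ring.
  rewrite (_ : 4 = 2 ^+ 2 :> R); last by rewrite !exprS expr0; ring.
  rewrite -!exprM (mulnC 4) (mulnC 2) !exprM /M.
  by move: (2 ^+ m) => y; field; rewrite !gt_eqF// ?divr_gt0 ?mulr_gt0 ?exprn_gt0.
by rewrite ler_peMr ?exprn_ge0// ler_pdivlMr// mul1r.
Qed.

(** If log t <= 2^m, the ratio is at least 1. Otherwise m log 2 <= log log t, so log m / 2 <= log
    log log t, and 9 log m <= (log log log t)^(1 + eps) once (log m / 2)^eps >= 18. *)
Lemma lower_rate (eps : R) : 0 < eps ->
  exists m0 t0 : nat, forall m t n : nat,
    (m0 <= m)%N -> (t0 <= t)%N -> (4 ^ m <= n)%N ->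
    ln (t%:R : R) <= 3 * (2 ^+ m * Num.sqrt (ln m%:R)) ->
    ln (ln (ln (t%:R : R))) `^ (- 1 - eps) <= n%:R / ln (t%:R : R) ^+ 2.
Proof.
move=> eps0.
have l2 : 0 < ln 2 :> R by rewrite ln_gt0// ltr1n.
(* The first term yields (log m / 2)^eps >= 18, the second absorbs the constant log log 2, and the 1
   keeps log m positive. *)
pose M : R := 2 * (18 `^ (eps^-1)) + 2 * `|ln (ln 2)| + 1.
have [m0 m0P] := ln_natr_large M.
have [t0 t0P] := ln_natr_large (expR (expR 1)).
exists m0.+1, t0 => m t n mm tt mn xm.
have x1 := t0P t tt; set x := ln t%:R in x1 xm *.
have x0 : 0 < x by apply: lt_le_trans x1; exact: expR_gt0.
have lx1 : expR 1 <= ln x by rewrite -[leLHS]expRK ler_ln ?posrE ?expR_gt0.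
have lx0 : 0 < ln x by apply: lt_le_trans lx1; exact: expR_gt0.
have L1 : 1 <= ln (ln x) by rewrite -[leLHS]expRK ler_ln ?posrE ?expR_gt0.
have L0 : 0 < ln (ln x) by exact: lt_le_trans ltr01 L1.
have -> : ln (ln x) `^ (- 1 - eps) = (ln (ln x) `^ (1 + eps))^-1.
  by rewrite -powRN; congr (_ `^ _); ring.
have n4 : 4 ^+ m <= n%:R :> R by rewrite -natrX ler_nat.
have e4 : (2 ^+ m) ^+ 2 = 4 ^+ m :> R.
  rewrite (_ : 4 = 2 ^+ 2 :> R); last by rewrite expr2; ring.
  by rewrite -!exprM mulnC.
have x2 : 0 < x ^+ 2 by rewrite exprn_gt0.
have [xm2|xm2] := leP x (2 ^+ m).
  apply: (@le_trans _ _ 1).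
    rewrite invf_le1 ?powR_gt0//.
    rewrite -[leLHS](powRr0 (ln (ln x))).
    by apply: ler_powR => //; rewrite addr_ge0// ltW.
  rewrite ler_pdivlMr// mul1r; apply: le_trans n4; rewrite -e4.
  by rewrite lerXn2r ?nnegrE ?exprn_ge0// ltW.
have lnm : M <= ln m%:R := m0P m (ltnW mm).
have m1 : 0 < m%:R :> R by rewrite ltr0n (leq_ltn_trans _ mm).
have lnm0 : 0 < ln m%:R :> R.
  apply: lt_le_trans lnm; rewrite /M.
  by rewrite ltr_wpDl// addr_ge0// mulr_ge0// powR_ge0.
have Lm : ln m%:R / 2 <= ln (ln x).
  have h1 : m%:R * ln 2 <= ln x.
    rewrite mulr_natl -lnXn// ler_ln ?posrE ?exprn_gt0// ltW//.
  have h2 : ln m%:R + ln (ln 2) <= ln (ln x).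
    by rewrite -lnM ?posrE// ler_ln ?posrE ?mulr_gt0.
  have h3 : - ln (ln 2 : R) <= `|ln (ln 2)| by rewrite -normrN ler_norm.
  have h4 : 0 <= 18 `^ (eps^-1) :> R by exact: powR_ge0.
  by move: lnm; rewrite /M; lra.
have Le : 18 <= (ln m%:R / 2) `^ eps.
  have -> : 18 = (18 `^ eps^-1) `^ eps :> R.
    by rewrite -powRrM mulVf ?gt_eqF// powRr1.
  apply: ge0_ler_powR; rewrite ?nnegrE ?powR_ge0 ?(ltW eps0)//.
    by rewrite divr_ge0// ltW.
  have h3 := normr_ge0 (ln (ln 2 : R)).
  by move: lnm; rewrite /M; lra.
have LL : 9 * ln m%:R <= ln (ln x) `^ (1 + eps).
  rewrite powRD; last by rewrite (gt_eqF L0) implybT.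
  rewrite powRr1 ?(ltW L0)//.
  apply: (@le_trans _ _ (ln m%:R / 2 * 18)); first by lra.
  apply: ler_pM => //; first by rewrite divr_ge0// ltW.
  apply: (le_trans Le); apply: ge0_ler_powR; rewrite ?nnegrE ?(ltW eps0) ?(ltW L0)//.
  by rewrite divr_ge0// ltW.
rewrite ler_pdivlMr// mulrC ler_pdivrMr ?powR_gt0//.
apply: (@le_trans _ _ (4 ^+ m * (9 * ln m%:R))); last first.
  by apply: ler_pM => //; rewrite ?exprn_ge0// mulr_ge0// ltW.
have : x ^+ 2 <= (3 * (2 ^+ m * Num.sqrt (ln m%:R))) ^+ 2.
  by rewrite lerXn2r ?nnegrE ?(ltW x0)// (le_trans (ltW x0)).
move/le_trans; apply; rewrite !exprMn sqr_sqrtr ?(ltW lnm0)// e4.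
by rewrite le_eqVlt; apply/orP; left; apply/eqP; ring.
Qed.

Lemma quenched_lower (kappa : R) : 0 < kappa -> (forall k, kappa <= 1 - p k) ->
  (forall N, exists2 m, (N <= m)%N & forall k, (k < 4 ^ m)%N ->
    `|potential p k| <= 2 ^+ m * Num.sqrt (ln m%:R)) ->
  forall eps : R, 0 < eps ->
  {ae Q, forall v, infinite_set [set t : nat |
    ln (ln (ln (t%:R : R))) `^ (- 1 - eps) <= (eta t v)%:R / ln (t%:R : R) ^+ 2]}.
Proof.
move=> kappa0 pk flat eps eps0.
pose b m : R := 2 ^+ m * Num.sqrt (ln m%:R).
(* The mean hitting time is of order 16^m exp (2 b), so the exponent 3 b leaves a factor exp (-b) <=
   exp (-2^m). *)
pose tm m := (Num.truncn (expR (3 * b m))).+1.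
pose A m := ~` confined eta (4 ^ m) (tm m).
have mA m : measurable (A m) by apply: measurableC; exact: measurable_confined.
have PA (e : R) N : 0 < e -> exists2 m, (N <= m)%N & ((1 - e)%:E <= Q (A m))%E.
  move=> e0; have [m1 m1P] := ln_natr_large 1.
  have [m2 m2P] := exists_exp_small kappa0 e0.
  (* Beyond r the walk starts below 4^m, beyond m1 one has b m >= 2^m, and beyond m2 the failure
     probability is at most e. *)
  have [m mm Vm] := flat (N + r + m1 + m2)%N.
  exists m; first by lia.
  rewrite /A probability_setC; last exact: measurable_confined.
  rewrite EFinB leeB//.
  have rm : (r < 4 ^ m)%N.
    by apply: (@leq_ltn_trans m); [lia|exact: ltn_expl].
  apply: (le_trans (confined_crossing walk p01 kappa0 rm (ltn0Sn _) pk Vm)).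
  rewrite lee_fin; apply: le_trans (m2P m ltac:(lia)).
  rewrite -/(b m).
  have bm : 2 ^+ m <= b m.
    rewrite /b ler_peMr ?exprn_ge0//.
    rewrite -[leLHS]sqrtr1 ler_wsqrtr//; apply: m1P; lia.
  have tmE : expR (3 * b m) <= (tm m)%:R.
    by have /truncn_itv/andP[_ /ltW] : 0 <= expR (3 * b m) by exact: expR_ge0.
  rewrite ler_pdivrMr; last by apply: lt_le_trans tmE; exact: expR_gt0.
  apply: (@le_trans _ _ (16 ^+ m / kappa * expR (- 2 ^+ m) * expR (3 * b m))); last first.
    by rewrite ler_wpM2l// mulr_ge0 ?expR_ge0// divr_ge0 ?exprn_ge0// ltW.
  rewrite natrX -exprM mulnC exprM (_ : 4%:R ^+ 2 = 16 :> R); last by ring.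
  rewrite -!mulrA ler_wpM2l ?exprn_ge0// mulrC ler_wpM2l ?invr_ge0 ?(ltW kappa0)//.
  by rewrite -expRD ler_expR; lra.
have := ae_infinitely_often mA PA; apply: filterS => v vA.
have [m0 [t0 rate]] := lower_rate eps0.
apply: infinite_set_unbounded => N.
pose N1 := (N + t0 + 1)%N.
(* Since 4^m > m exceeds each of the first N1 positions of this path, the level 4^m is reached only
   after time N1; hence the times found are unbounded. *)
have [m mm] := vA (m0 + \sum_(l < N1) eta l v)%N.
rewrite /A /= => /existsNP[t /not_implyP[tm_t /negP]]; rewrite -leqNgt => mt.
have tN1 : (N1 <= t)%N.
  rewrite leqNgt; apply/negP => tN1.
  have h1 : (eta t v <= \sum_(l < N1) eta l v)%N.
    by rewrite (bigD1 (Ordinal tN1)) //= leq_addr.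
  have h2 : (m < 4 ^ m)%N by exact: ltn_expl.
  by move: mm mt h1 h2; lia.
have t_gt0 : 0 < t%:R :> R by rewrite ltr0n; move: tN1; rewrite /N1; lia.
exists t; first by move: tN1; rewrite /N1; lia.
apply: (rate m) => //; [by lia|by move: tN1; rewrite /N1; lia|].
rewrite -[leRHS]expRK ler_ln ?posrE ?expR_gt0//.
by rewrite -truncn_ge_nat ?expR_ge0.
Qed.

End QuenchedLimits.

(** * Fluctuations of the potential *)

Section Fluctuations.
Context d (T : measurableType d) d' (S : measurableType d') (R : realType).
Variables (P : probability T R) (Z : nat -> T -> S).
Hypothesis mZ : forall i, measurable_fun setT (Z i).
Hypothesis indepZ : mutually_independent P Z.
Variables (phi : nat -> S -> R) (K : R) (n0 : nat).
Hypothesis mphi : forall l, measurable_fun setT (phi l).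
Hypothesis phiK : forall l z, `|phi l z| <= K.
Hypothesis phi0 : forall l, (n0 <= l)%N -> \int[P]_w phi l (Z l w) = 0.

Definition partial_sum k w := \sum_(l < k) phi l (Z l w).

Lemma partial_sumD i m w :
  partial_sum (i + m) w = partial_sum i w + increment_sum Z phi i m w.
Proof.
rewrite /partial_sum /increment_sum.
rewrite -(big_mkord xpredT (fun l => phi l (Z l w))).
rewrite -(big_mkord xpredT (fun l => phi l (Z l w))).
by rewrite (@big_cat_nat _ _ _ i)//= leq_addr.
Qed.

Lemma partial_sum_le k w : `|partial_sum k w| <= K * k%:R.
Proof.
apply: (le_trans (ler_norm_sum _ _ _)).
apply: (@le_trans _ _ (\sum_(l < k) K)); first by apply: ler_sum => l _.
by rewrite sumr_const card_ord mulr_natr.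
Qed.

Lemma running_max_tail n (c : R) : 0 < c ->
  (P [set w | (c <= running_max Z phi n0 n w)%R] <=
   (4 * K ^+ 2 * n%:R / c ^+ 2)%:E)%E.
Proof.
move=> c0.
have kM := bounded_past_running_max Z mphi phiK (leqnn (n0 + n)).
have -> : [set w | c <= running_max Z phi n0 n w] =
    [set w | c ^+ 2 <= running_max Z phi n0 n w ^+ 2].
  apply/seteqP; split => w /=; rewrite ler_pXn2r ?nnegrE ?(ltW c0)//;
    exact: running_max_ge0.
apply: le_trans (bounded_past_markov P mZ (exprn_gt0 2 c0) (bounded_pastX 2 kM)
  (fun w => sqr_ge0 _)) _.
rewrite lee_fin ler_pM2r ?invr_gt0 ?exprn_gt0//.
exact: (Rintegral_running_max mZ indepZ mphi phiK phi0).
Qed.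

End Fluctuations.

Section FluctuationsAE.
Context d (T : measurableType d) d' (S : measurableType d') (R : realType).
Variables (P : probability T R) (Z : nat -> T -> S).
Hypothesis mZ : forall i, measurable_fun setT (Z i).
Hypothesis indepZ : mutually_independent P Z.
Variables (phi : nat -> S -> R) (K v : R) (n0 : nat).
Hypothesis mphi : forall l, measurable_fun setT (phi l).
Hypothesis phiK : forall l z, `|phi l z| <= K.
Hypothesis phi0 : forall l, (n0 <= l)%N -> \int[P]_w phi l (Z l w) = 0.
Local Notation V := (partial_sum Z phi).

Lemma measurable_partial_sum k : measurable_fun setT (V k).
Proof.
by apply: measurable_sum => l; exact: measurableT_comp.
Qed.

Lemma ae_partial_sum_flat :
  {ae P, forall w, forall N, exists2 m, (N <= m)%N & forall k, (k < 4 ^ m)%N ->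
     `|V k w| <= 2 ^+ m * Num.sqrt (ln m%:R)}.
Proof.
have K0 : 0 <= K by exact: le_trans (normr_ge0 _) (phiK 0 point).
(* The opposite increments control the minimum of the potential. *)
pose phi' l z := - phi l z.
have mphi' l : measurable_fun setT (phi' l) by exact: measurable_funN.
have phiK' l z : `|phi' l z| <= K by rewrite normrN.
have phi0' l : (n0 <= l)%N -> \int[P]_w phi' l (Z l w) = 0.
  move=> nl; have bX := bounded_past_X Z mphi phiK (ltnSn l).
  under eq_Rintegral do rewrite /phi' -mulN1r.
  by rewrite (bounded_past_EZ P mZ (-1) bX) phi0// mulr0.
have Sum' i m w : increment_sum Z phi' i m w = - increment_sum Z phi i m w.
  by rewrite /increment_sum -sumrN.
pose b m : R := 2 ^+ m * Num.sqrt (ln m%:R).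
pose A m := [set w | forall k, (k < 4 ^ m)%N -> `|V k w| <= b m].
have mA m : measurable (A m).
  rewrite (_ : A m = \bigcap_(k in `I_(4 ^ m)) [set w | `|V k w| <= b m]).
    apply: bigcap_measurableType => k _.
    apply: (@measurable_sublevel _ _ _ (fun w => `|V k w|)).
    by apply: measurableT_comp => //; exact: measurable_partial_sum.
  by apply/seteqP; split => w.
apply: (@ae_infinitely_often _ _ _ P A) => //.
move=> e N e0.
(* At level b / 2 each one-sided maximum has tail at most 16 K^2 / log m, which must be at most e /
   2. *)
have [m1 m1P] := ln_natr_large (Num.max 1 (32 * K ^+ 2 / e)).
(* The first n0 terms, which need not be centred, then contribute at most 2^m / 2 <= b / 2. *)
have [m2 m2P] : exists m2 : nat, 2 * (K * n0%:R) <= m2%:R.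
  exists (Num.bound (2 * (K * n0%:R))); apply/ltW/archi_boundP.
  by rewrite mulr_ge0// mulr_ge0.
pose m := (N + m1 + m2)%N; exists m; first by rewrite /m; lia.
have := m1P m ltac:(rewrite /m; lia); rewrite ge_max => /andP[lm1 lme].
have m2m : 2 * (K * n0%:R) <= 2 ^+ m.
  apply: (le_trans m2P); apply: le_trans (ltW (exp2_gt R m)).
  by rewrite ler_nat /m; lia.
move: m lm1 lme m2m => m lm1 lme m2m.
have s1 : 1 <= Num.sqrt (ln m%:R) :> R by rewrite -[leLHS]sqrtr1 ler_wsqrtr.
have b2m : 2 ^+ m <= b m by rewrite /b ler_peMr ?exprn_ge0.
have b0 : 0 < b m by apply: lt_le_trans b2m; rewrite exprn_gt0.
pose B psi := [set w | b m / 2 <= running_max Z psi n0 (4 ^ m) w].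
have PB (psi : nat -> S -> R) : (forall l, measurable_fun setT (psi l)) ->
    (forall l z, `|psi l z| <= K) ->
    (forall l, (n0 <= l)%N -> \int[P]_w psi l (Z l w) = 0) ->
    measurable (B psi) /\ (P (B psi) <= (e / 2)%:E)%E.
  move=> mpsi psiK psi0; split.
    apply: measurable_superlevel.
    have [mM _] := bounded_past_running_max Z mpsi psiK (leqnn (n0 + 4 ^ m)).
    exact: (past_measurable_fun mZ mM).
  apply: (le_trans (running_max_tail mZ indepZ mpsi psiK psi0 _ _)).
    by rewrite divr_gt0.
  rewrite lee_fin ler_pdivrMr ?exprn_gt0 ?divr_gt0//.
  rewrite expr_div_n /b exprMn sqr_sqrtr ?(le_trans ler01)//.
  rewrite natrX -exprM mulnC exprM (_ : 2 ^+ 2 = 4%:R :> R); last by ring.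
  move: lme; rewrite ler_pdivrMr// => lme.
  have : 0 <= (4%:R : R) ^+ m by rewrite exprn_ge0.
  by move: (4%:R ^+ m) => y y0; nra.
have [mB1 PB1] := PB _ mphi phiK phi0.
have [mB2 PB2] := PB _ mphi' phiK' phi0'.
have AB : ~` A m `<=` B phi `|` B phi'.
  move=> w nA; apply: contrapT => nB; apply: nA => k k4.
  have /not_orP[/= /negP + /negP] := nB; rewrite -!ltNge => B1 B2.
  have [kn|kn] := leqP k n0.
    apply: (le_trans (partial_sum_le Z phiK k w)).
    apply: (@le_trans _ _ (K * n0%:R)); first by rewrite ler_wpM2l// ler_nat.
    have : 0 <= K * n0%:R by rewrite mulr_ge0.
    by lra.
  have kE : k = (n0 + (k - n0))%N by rewrite subnKC// ltnW.
  have kn4 : (k - n0 <= 4 ^ m)%N by exact: leq_trans (leq_subr _ _) (ltnW k4).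
  rewrite kE partial_sumD.
  have := partial_sum_le Z phiK n0 w; rewrite !ler_norml.
  have := increment_sum_le_running_max Z phi n0 w kn4.
  have := increment_sum_le_running_max Z phi' n0 w kn4.
  by rewrite Sum'; lra.
have PA : (P (~` A m) <= e%:E)%E.
  apply: (@le_trans _ _ (P (B phi `|` B phi'))).
    by apply: le_measure AB; rewrite inE; [exact: measurableC|exact: measurableU].
  apply: (le_trans (measureU2 P mB1 mB2)).
  by rewrite [e]splitr EFinD leeD.
rewrite -(setCK (A m)) probability_setC; last exact: measurableC.
by rewrite EFinB leeB.
Qed.

Hypothesis v0 : 0 < v.
Hypothesis phi2 : forall l, (n0 <= l)%N -> v <= \int[P]_w (phi l (Z l w) ^+ 2).

Lemma ae_partial_sum_jumps : exists2 a : R, 0 < a & forall r,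
  {ae P, forall w, exists k0, forall k, (k0 <= k)%N -> exists i j,
    [/\ (r <= i)%N, (i <= j)%N, (j <= (n0 + r) + k * 4 ^ k)%N &
        a * 2 ^+ k <= V j w - V i w]}.
Proof.
have v_gt0 := v0.
have K0 : 0 <= K by exact: le_trans (normr_ge0 _) (phiK 0 point).
(* As b >= 1 gives b <= b^2, these bounds yield [bKv] and make the jump probability v / (2 b^2) at
   most 1. *)
have [b b1 [vb Kb]] : exists2 b : R, 1 <= b & v <= b /\ 16 * K ^+ 4 <= v * b.
  have [u u0 ->] : exists2 u : R, 0 <= u & 16 * K ^+ 4 = v * u.
    exists (16 * K ^+ 4 / v).
      by rewrite divr_ge0 ?mulr_ge0 ?exprn_ge0// ltW.
    by field; rewrite gt_eqF.
  exists (u + v + 1); first by lra.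
  by split; [lra|rewrite ler_wpM2l ?ltW//; lra].
have b0 : 0 < b by lra.
(* Then a (1 + b) = v / 4 and a <= 1, so a^2 + a b / 2 <= a + a b = v / 4. *)
pose a := v / (4 * (1 + b)).
have a0 : 0 < a by rewrite divr_gt0//; lra.
have a1 : a <= 1 by rewrite ler_pdivrMr; lra.
have ab : a * (1 + b) = v / 4 by rewrite /a; field; lra.
have bb : b <= b ^+ 2 by rewrite expr2 ler_peMl// ltW.
have bKv : 16 * K ^+ 4 <= v * b ^+ 2.
  by rewrite (le_trans Kb)// ler_wpM2l// ltW.
have abv : a ^+ 2 + b * a / 2 <= v / 4.
  rewrite -ab; have : a ^+ 2 <= a by rewrite expr2 ler_piMl// ltW.
  have : 0 <= a * b by rewrite mulr_ge0 ?ltW.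
  by lra.
pose p0 := v / (2 * b ^+ 2).
have b20 : 0 < 2 * b ^+ 2 by rewrite mulr_gt0// exprn_gt0.
have p0_gt0 : 0 < p0 by rewrite divr_gt0.
have p0_le1 : p0 <= 1 by rewrite ler_pdivrMr//; lra.
exists a => // r.
(* The blocks start at n0 + r, where the increments are centred and the walk has the barrier in
   front of it. *)
pose f k := no_jump Z phi a (2 ^+ k) (4 ^ k) (n0 + r) k.
have kf k : bounded_past Z (n0 + r + k * 4 ^ k) (f k).
  exact: (bounded_past_no_jump Z mphi phiK).
(* [f k] takes only the values 0 and 1, so this is the event that none of the k blocks jumps. *)
pose A k := [set w | 1 <= f k w].
have mA k : measurable (A k).
  by apply: measurable_superlevel; exact: (past_measurable_fun mZ (kf k).1).
have PA k : (P (A k) <= (1 * (1 - p0) ^+ k)%:E)%E.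
  apply: (le_trans (bounded_past_markov P mZ ltr01 (kf k)
    (fun w => no_jump_ge0 _ _ _ _ _ _ _ w))).
  rewrite lee_fin divr1 mul1r.
  apply: (Rintegral_no_jump mZ indepZ mphi phiK phi0 phi2 b0 (ltW a0) _ (ltW v0)
    bKv abv) => //; last exact: leq_addr.
  by rewrite natrX -exprM mulnC exprM; congr (_ ^+ _); ring.
have p01 : 0 <= 1 - p0 < 1 by apply/andP; split; lra.
have := ae_eventually_not ler01 p01 mA PA; apply: filterS => w [k0 wk].
exists k0 => k kk; have := wk k kk; rewrite /A /=.
have [/existsP[l jl] _|/existsPn nojump []] := boolP [exists l : 'I_k,
  a * 2 ^+ k < increment_sum Z phi (n0 + r + l * 4 ^ k) (4 ^ k) w].
  exists (n0 + r + l * 4 ^ k)%N, (n0 + r + l * 4 ^ k + 4 ^ k)%N; split.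
  - by rewrite -addnA addnCA leq_addr.
  - exact: leq_addr.
  - by rewrite -addnA leq_add2l -mulSnr leq_mul2r ltn_ord orbT.
  - by rewrite partial_sumD addrC addKr ltW.
rewrite /f /no_jump big1// => l _.
by rewrite (negbTE (nojump l)) subr0.
Qed.

End FluctuationsAE.

(** * Log-odds under truncation and perturbation *)

Section Truncation.
Context (R : realType).
Implicit Types a b c u x y delta : R.

Lemma truncate_itv a b x : a <= b -> a <= truncate a b x <= b.
Proof.
move=> ab; rewrite /truncate; case: ltP => [xa|ax]; first by rewrite lexx.
by case: ltP => [bx|xb]; rewrite ?lexx ?ab ?ax.
Qed.

Lemma truncate_id a b x : a <= x <= b -> truncate a b x = x.
Proof. by move=> /andP[ax xb]; rewrite /truncate ltNge ax /= ltNge xb. Qed.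

Lemma measurable_truncate a b : a <= b -> measurable_fun setT (truncate a b).
Proof.
move=> ab; rewrite (_ : truncate a b = fun x => Num.max a (Num.min x b)).
  by apply: measurable_maxr => //; apply: measurable_minr.
apply/funext => x; rewrite /truncate /Num.max /Num.min.
case: (ltP x a) => [xa|ax].
  by rewrite (lt_le_trans xa ab) ltNge (ltW xa).
case: (ltP b x) => [bx|xb].
  rewrite [x < b]ltNge (ltW bx) /=; case: ltP => // ba.
  by apply/eqP; rewrite eq_le ab ba.
move: xb; rewrite le_eqVlt => /predU1P[->|xb].
  by rewrite ltxx; case: ltP => // ba; apply/eqP; rewrite eq_le ab ba.
rewrite xb; case: ltP => // xa.
by apply/eqP; rewrite eq_le ax xa.
Qed.

Lemma measurable_inv : measurable_fun setT (@GRing.inv R).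
Proof.
rewrite -(setvU [set 0 : R]); apply/measurable_funU => //.
  exact: measurableC.
split; last exact: measurable_fun_set1.
apply: open_continuous_measurable_fun.
  by rewrite openC; exact: closed_eq.
by move=> x /set_mem /= /eqP x0; exact: inv_continuous.
Qed.

Lemma exists_small_sqr x : 0 < x -> exists2 y, 0 < y & 16 * y ^+ 2 <= x / 4.
Proof.
move=> x0; exists (Num.min (1 / 16) (x / 64)).
  by rewrite lt_min !divr_gt0.
set y := Num.min _ _.
have y0 : 0 <= y by rewrite le_min !divr_ge0// ltW.
have y1 : y <= 1 / 16 by rewrite ge_min lexx.
have y2 : y <= x / 64 by rewrite ge_min lexx orbT.
by move: y y0 y1 y2 => y y0 y1 y2; nra.
Qed.

Definition log_ratio x : R := ln (x / (1 - x)).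

Lemma measurable_log_ratio : measurable_fun setT log_ratio.
Proof.
apply: measurableT_comp; first exact: measurable_ln.
apply: measurable_funM => //; apply: measurableT_comp; first exact: measurable_inv.
exact: measurable_funB.
Qed.

Lemma log_ratio_bound a x : 0 < a -> a <= x <= 1 - a ->
  `|log_ratio x| <= ln ((1 - a) / a).
Proof.
move=> a0 /andP[ax xa]; have x0 : 0 < x by exact: lt_le_trans ax.
have x1 : 0 < 1 - x by lra.
have a1 : 0 < 1 - a by lra.
have xx0 : 0 < x / (1 - x) by rewrite divr_gt0.
have aa0 : 0 < (1 - a) / a by rewrite divr_gt0.
rewrite /log_ratio ler_norml -lnV ?posrE// !ler_ln ?posrE ?invr_gt0//.
rewrite invf_div ler_pdivlMr// ler_pdivrMr// !(mulrC _ (1 - x)) !mulrA.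
rewrite ler_pdivrMr// ler_pdivlMr//.
by apply/andP; split; nra.
Qed.

(* log(1 + u) as a bounded function: only arguments |u| <= 1/2 matter. *)
Definition log1p_trunc u : R := ln (1 + truncate (- (1 / 2)) (1 / 2) u).

Lemma log1p_truncE u : `|u| <= 1 / 2 -> log1p_trunc u = ln (1 + u).
Proof. by move=> u2; rewrite /log1p_trunc truncate_id// -ler_norml. Qed.

Lemma measurable_log1p_trunc : measurable_fun setT log1p_trunc.
Proof.
apply: measurableT_comp; first exact: measurable_ln.
apply: measurable_funD => //; apply: measurable_truncate; lra.
Qed.

Lemma ln1p_bound u : `|u| <= 1 / 2 -> `|ln (1 + u)| <= 2 * `|u|.
Proof.
rewrite ler_norml => /andP[u1 u2].
have upper : ln (1 + u) <= u by apply: le_ln1Dx; lra.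
have lower : u / (1 + u) <= ln (1 + u).
  (* The lower bound is the upper bound applied to 1 / (1 + u) = 1 - u / (1 + u). *)
  have h : ln (1 + - (u / (1 + u))) <= - (u / (1 + u)).
    apply: le_ln1Dx; rewrite ltrN2 ltr_pdivrMr; lra.
  rewrite -lerN2; apply: le_trans h; rewrite -lnV ?posrE; last by lra.
  rewrite (_ : 1 + - (u / (1 + u)) = (1 + u)^-1)//.
  by field; rewrite gt_eqF//; lra.
rewrite ler_norml; apply/andP; split.
  apply: le_trans lower; rewrite ler_pdivlMr; last by lra.
  by have := ler_norm (- u); have := ler_norm u; rewrite normrN; nra.
by apply: (le_trans upper); have := ler_norm u; have := normr_ge0 u; lra.
Qed.

Lemma log1p_trunc_bound u : `|log1p_trunc u| <= 1.
Proof.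
have t2 : `|truncate (- (1 / 2)) (1 / 2) u| <= 1 / 2.
  by rewrite ler_norml truncate_itv//; lra.
apply: (le_trans (ln1p_bound t2)); lra.
Qed.

(** For c <= delta / 2 no truncation acts and both logarithms have arguments within 1/2 of 1, so the
    identity is an exact factorisation of the odds. The truncations are kept on the right to make
    each term bounded everywhere. *)
Lemma log_ratio_perturb delta c x y : 0 < delta -> delta < 1 / 2 ->
  0 <= c <= delta / 2 -> delta <= x <= 1 - delta -> -1 <= y <= 1 ->
  log_ratio (truncate (delta / 2) (1 - delta / 2) (x + y * c)) =
  log_ratio (truncate (delta / 2) (1 - delta / 2) x)
    + (log1p_trunc (c * (y / x)) - log1p_trunc (c * (- (y / (1 - x))))) /\
  `|log1p_trunc (c * (y / x)) - log1p_trunc (c * (- (y / (1 - x))))|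
    <= 4 * c / delta.
Proof.
move=> d0 d1 /andP[c0 c1] /andP[x0 x1] /andP[y0 y1].
have yc : `|y * c| <= c by rewrite ler_norml; apply/andP; split; nra.
have xp : 0 < x by lra.
have xq : 0 < 1 - x by lra.
have B (z : R) : delta <= z -> `|c * (y / z)| <= c / delta.
  move=> dz; have z0 : 0 < z by lra.
  rewrite mulrA [c * y]mulrC normrM [X in _ * X]ger0_norm ?invr_ge0 ?(ltW z0)//.
  apply: ler_pM => //; first by rewrite invr_ge0 ltW.
  by rewrite lef_pV2 ?posrE.
have c2 : c / delta <= 1 / 2 by rewrite ler_pdivrMr//; lra.
have b1 := B x x0.
have b2 : `|c * (- (y / (1 - x)))| <= c / delta by rewrite mulrN normrN B//; lra.
have b1' := le_trans b1 c2; have b2' := le_trans b2 c2.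
rewrite !log1p_truncE//; split; last first.
  apply: (le_trans (ler_normB _ _)).
  by have := ln1p_bound b1'; have := ln1p_bound b2'; lra.
have xyc : delta / 2 <= x + y * c <= 1 - delta / 2.
  by move: yc; rewrite ler_norml => /andP[]; lra.
rewrite !truncate_id//; last by lra.
move: xyc b1' b2'; rewrite !ler_norml => /andP[xyc0 xyc1] /andP[b1' _] /andP[b2' _].
have p1 : 0 < 1 + c * (y / x) by lra.
have p2 : 0 < 1 + c * - (y / (1 - x)) by lra.
have p3 : 0 < x / (1 - x) by rewrite divr_gt0.
rewrite /log_ratio -lnV ?posrE// -lnM ?posrE ?invr_gt0//.
rewrite -lnM ?posrE ?mulr_gt0 ?invr_gt0//; congr ln.
have xnq : 1 - x != 0 by rewrite gt_eqF.
have xn0 : x != 0 by rewrite gt_eqF.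
have p2' : 1 + c * - (y / (1 - x)) = (1 - (x + y * c)) / (1 - x) by field.
have p1' : 1 + c * (y / x) = (x + y * c) / x by field.
rewrite p1' p2'; field; rewrite xnq xn0 /= gt_eqF//; lra.
Qed.

End Truncation.

(** * Mean and variance of the increments of the potential *)

Section EnvironmentPotential.
Context (R : realType) (d : measure_display) (T : measurableType d).
Variables (P : probability T R) (delta alpha : R) (xi Y : nat -> {RV P >-> R}).
Hypothesis hdelta : 0 < delta < 1 / 2.
Hypothesis halpha : 0 < alpha.
Hypothesis hiid : iid P (fun i w => (xi i.+1 w, Y i.+1 w)).
Hypothesis hxi : P [set w | delta <= xi 1%N w <= 1 - delta] = 1%E.
Hypothesis hY : P [set w | -1 <= Y 1%N w <= 1] = 1%E.
Hypothesis hzeta : ('E_P[zeta xi 1%N] = 0)%E.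
Hypothesis hs : (0 < 'V_P[xi 1%N])%E.
Hypothesis hdist : eq_in_dist P (fun w => Y 1%N w / xi 1%N w)
                        (fun w => - (Y 1%N w / (1 - xi 1%N w))).

Definition env_pair i w := (xi i.+1 w, Y i.+1 w).
Local Notation Z := env_pair.
Local Notation clip := (truncate (delta / 2) (1 - delta / 2)).

(** Index l stands for site l + 1, so that the partial sums of [log_odds l (Z l w)] are by
    conversion the [potential] of the environment; clipping bounds it for all z. *)
Definition log_odds l (z : R * R) : R :=
  log_ratio (clip (z.1 + z.2 * l.+1%:R `^ (- alpha))).

Lemma clip_itv x : delta / 2 <= clip x <= 1 - delta / 2.
Proof. by apply: truncate_itv; move/andP: hdelta => []; lra. Qed.

Lemma environment_itv w n :
  delta / 2 <= environment delta alpha xi Y w n <= 1 - delta / 2.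
Proof.
case: n => [|n]; last exact: clip_itv.
by rewrite /environment; move/andP: hdelta => []; lra.
Qed.

Lemma measurable_env_pair i : measurable_fun setT (Z i).
Proof. by apply: measurable_fun_pair; exact: measurable_funPT. Qed.

Lemma measurable_clip : measurable_fun setT clip.
Proof. by apply: measurable_truncate; move/andP: hdelta => []; lra. Qed.

Lemma measurable_log_odds l : measurable_fun setT (log_odds l).
Proof.
apply: measurableT_comp; first exact: measurable_log_ratio.
apply: measurableT_comp; first exact: measurable_clip.
by apply: measurable_funD => //; exact: measurable_funM.
Qed.

Let K : R := ln ((1 - delta / 2) / (delta / 2)).

Lemma log_odds_bound l z : `|log_odds l z| <= K.
Proof.
apply: log_ratio_bound; last exact: clip_itv.
by move/andP: hdelta => []; lra.
Qed.

Lemma ae_of_probability1 A : measurable A -> P A = 1%E -> {ae P, forall w, A w}.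
Proof.
move=> mA PA; exists (~` A); split => //; first exact: measurableC.
by rewrite probability_setC// PA subee.
Qed.

Lemma ae_env_range :
  {ae P, forall w, delta <= xi 1%N w <= 1 - delta /\ -1 <= Y 1%N w <= 1}.
Proof.
have m1 (X : {RV P >-> R}) a b : measurable [set w | a <= X w <= b].
  rewrite (_ : [set w | _] = [set w | a <= X w] `&` [set w | X w <= b]).
    apply: measurableI.
      by apply: measurable_superlevel; exact: measurable_funPT.
    by apply: measurable_sublevel; exact: measurable_funPT.
  by apply/seteqP; split => w /= => [/andP[]//|[-> ->]].
have h1 := ae_of_probability1 (m1 (xi 1%N) _ _) hxi.
have h2 := ae_of_probability1 (m1 (Y 1%N) _ _) hY.
by apply: filterS2 h1 h2 => w.
Qed.

Lemma ae_eq_Rintegral (f g : T -> R) : measurable_fun setT f ->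
  measurable_fun setT g -> {ae P, forall w, f w = g w} ->
  \int[P]_w f w = \int[P]_w g w.
Proof.
move=> mf mg fg; congr fine; apply: ae_eq_integral => //.
- exact/measurable_EFinP.
- exact/measurable_EFinP.
- by apply: filterS fg => w -> _.
Qed.

Lemma eq_in_dist_Rintegral d' (S : measurableType d') (X X' : T -> S)
    (f : S -> R) (M : R) :
  measurable_fun setT X -> measurable_fun setT X' -> eq_in_dist P X X' ->
  measurable_fun setT f -> (forall z, `|f z| <= M) ->
  \int[P]_w f (X w) = \int[P]_w f (X' w).
Proof.
move=> mX mX' XX' mf fM.
pose rX : {RV P >-> S} := mfun_Sub (mem_set mX).
pose rX' : {RV P >-> S} := mfun_Sub (mem_set mX').
have E (V : {RV P >-> S}) :
    (\int[P]_w (f (V w))%:E = \int[distribution P V]_z (f z)%:E)%E.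
  rewrite integral_distribution//; first exact/measurable_EFinP.
  apply: (@bounded_probability_integrable _ _ _ P _ M) => //.
  by apply: measurableT_comp => //; exact: measurable_funPT.
congr fine; rewrite (E rX) (E rX').
by apply: eq_measure_integral => A mA _; exact: XX'.
Qed.

Lemma Rintegral_env_pair l (f : R * R -> R) (M : R) :
  measurable_fun setT f -> (forall z, `|f z| <= M) ->
  \int[P]_w f (Z l w) = \int[P]_w f (Z 0 w).
Proof.
move=> mf fM; apply: (eq_in_dist_Rintegral (measurable_env_pair l)
  (measurable_env_pair 0) _ mf fM).
exact: hiid.2.
Qed.

(** Almost surely equal to [zeta xi 1], but bounded at every sample point. *)
Let zeta' w := log_ratio (clip (xi 1%N w)).

Let mzeta' : measurable_fun setT zeta'.
Proof.
apply: measurableT_comp; first exact: measurable_log_ratio.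
by apply: measurableT_comp; [exact: measurable_clip|exact: measurable_funPT].
Qed.

Let zeta'K w : `|zeta' w| <= K.
Proof.
apply: log_ratio_bound; last exact: clip_itv.
by move/andP: hdelta => []; lra.
Qed.

Let zeta'_int : \int[P]_w zeta' w = 0.
Proof.
have /(congr1 fine) /= : ('E_P[zeta xi 1%N] = 0)%E := hzeta.
rewrite unlock => <-; apply: ae_eq_Rintegral => //.
  exact: (measurableT_comp (@measurable_log_ratio R)
    (measurable_funPT (xi 1%N))).
apply: filterS ae_env_range => w [x01 _].
rewrite /zeta' truncate_id//; move/andP: hdelta => [d0 d1]; move/andP: x01 => []; lra.
Qed.

(** A vanishing second moment would force xi = 1/2 almost surely, against the positive variance of
    xi. *)
Let zeta'_var : 0 < \int[P]_w (zeta' w ^+ 2).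
Proof.
rewrite lt_neqAle Rintegral_ge0 ?andbT; last by move=> w _; exact: sqr_ge0.
apply/negP => /eqP z0.
have mz2 : measurable_fun setT (fun w => zeta' w ^+ 2) by exact: measurable_funX.
have iz2 : P.-integrable setT (EFin \o (fun w => zeta' w ^+ 2)).
  apply: (@bounded_probability_integrable _ _ _ P _ (K ^+ 2)) => // w.
  rewrite normrX lerXn2r ?nnegrE ?zeta'K//.
  exact: le_trans (normr_ge0 _) (zeta'K w).
have ae0 : {ae P, forall w, xi 1%N w = 1 / 2}.
  have /ae_eq_integral_abs : (\int[P]_w `|(zeta' w ^+ 2)%:E| = 0)%E.
    under eq_integral do rewrite gee0_abs ?lee_fin ?sqr_ge0//.
    by rewrite -[LHS]fineK ?integrable_fin_num// -[fine _]z0.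
  move=> /(_ measurableT) h.
  have {}h : ae_eq P setT (fun w => (zeta' w ^+ 2)%:E) (cst 0%E).
    by apply: h; exact/measurable_EFinP.
  apply: filterS2 h ae_env_range => w /(_ I) /= [] /eqP.
  rewrite sqrf_eq0 => /eqP zw [x01 _].
  move: zw; rewrite /zeta' truncate_id; last first.
    by move/andP: hdelta => [d0 d1]; move/andP: x01 => []; lra.
  rewrite /log_ratio => /eqP; move/andP: hdelta => [d0 d1]; move/andP: x01 => [x0 x1].
  have xq : 0 < 1 - xi 1%N w by lra.
  rewrite ln_eq0 ?divr_gt0//; last by lra.
  rewrite -subr_eq0 -[X in _ - X](divff (lt0r_neq0 xq)) -mulrBl mulf_eq0.
  rewrite invr_eq0 (gt_eqF xq) orbF => /eqP; lra.
have E2 : (fine 'E_P[xi 1%N] = 1 / 2)%R.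
  rewrite unlock -[RHS](Rintegral_cst_probability P (1 / 2)).
  by apply: ae_eq_Rintegral => //; exact: measurable_funPT.
have : ('V_P[xi 1%N] = 0)%E.
  rewrite /variance covariance.unlock E2 unlock.
  rewrite -[RHS](integral0 P setT); apply: ae_eq_integral => //.
    apply/measurable_EFinP; apply: measurable_funM;
      by apply: measurable_funB => //; exact: measurable_funPT.
  apply: filterS ae0 => w xw _.
  change (((xi 1%N w - 1 / 2) * (xi 1%N w - 1 / 2))%:E = 0%E).
  by rewrite xw subrr mul0r.
by move=> V0; move: hs; rewrite V0 ltxx.
Qed.

Let mratio : measurable_fun setT (fun w => Y 1%N w / xi 1%N w).
Proof.
apply: measurable_funM; first exact: measurable_funPT.
by apply: measurableT_comp; [exact: measurable_inv|exact: measurable_funPT].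
Qed.

Let mratio' : measurable_fun setT (fun w => - (Y 1%N w / (1 - xi 1%N w))).
Proof.
apply: measurable_funN; apply: measurable_funM; first exact: measurable_funPT.
apply: measurableT_comp; first exact: measurable_inv.
by apply: measurable_funB => //; exact: measurable_funPT.
Qed.

Let psi c w : R := log1p_trunc (c * (Y 1%N w / xi 1%N w))
  - log1p_trunc (c * (- (Y 1%N w / (1 - xi 1%N w)))).

Let mlog1p c : measurable_fun setT (fun u : R => log1p_trunc (c * u)).
Proof. by apply: measurableT_comp => //; exact: measurable_log1p_trunc. Qed.

Let mpsi c : measurable_fun setT (psi c).
Proof.
apply: measurable_funB.
  exact: (measurableT_comp (mlog1p c) mratio).
exact: (measurableT_comp (mlog1p c) mratio').
Qed.

(* The two halves of the perturbation have the same law, hence the same mean. *)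
Let psi_int c : \int[P]_w psi c w = 0.
Proof.
have b1 (V : T -> R) : measurable_fun setT V ->
    P.-integrable setT (EFin \o (fun w => log1p_trunc (c * V w))).
  move=> mV; apply: (@bounded_probability_integrable _ _ _ P _ 1) => //.
    exact: (measurableT_comp (mlog1p c) mV).
  by move=> w; exact: log1p_trunc_bound.
rewrite RintegralB//; [|exact: b1|exact: b1].
rewrite (@eq_in_dist_Rintegral _ _ _ _ (fun u => log1p_trunc (c * u)) 1
  mratio mratio' hdist (mlog1p c)) ?subrr// => u.
exact: log1p_trunc_bound.
Qed.

Lemma powR_small (e : R) : 0 < e ->
  exists n0, forall l, (n0 <= l)%N -> (l.+1%:R : R) `^ (- alpha) <= e.
Proof.
move=> e0; exists (Num.bound (e^-1 `^ alpha^-1)) => l ln.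
have h : e^-1 `^ alpha^-1 <= l.+1%:R.
  apply/ltW/(lt_le_trans (archi_boundP (powR_ge0 _ _))).
  by rewrite ler_nat (leq_trans ln).
rewrite powRN -[e]invrK lef_pV2 ?posrE ?invr_gt0 ?powR_gt0//.
have -> : e^-1 = (e^-1 `^ alpha^-1) `^ alpha.
  by rewrite -powRrM mulVf ?gt_eqF// powRr1// invr_ge0 ltW.
by apply: ge0_ler_powR; rewrite ?nnegrE ?powR_ge0// ltW.
Qed.

(** All moments are computed with the first pair, by equality in law. For the variance, (z + y)^2 >=
    z^2 / 2 - y^2 with y the perturbation, and y^2 is at most a quarter of E z^2 for large l. *)
Lemma log_odds_moments : exists v n0, [/\ 0 < v,
  forall l, (n0 <= l)%N -> \int[P]_w log_odds l (Z l w) = 0 &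
  forall l, (n0 <= l)%N -> v <= \int[P]_w (log_odds l (Z l w) ^+ 2)].
Proof.
have /andP[d0 d1] := hdelta.
pose v := \int[P]_w (zeta' w ^+ 2); have v0 : 0 < v := zeta'_var.
have [v1 v10 v1v] := exists_small_sqr v0.
(* The first bound keeps the truncation inactive, the second keeps the perturbation below 4 v1. *)
pose e := Num.min (delta / 2) (v1 * delta).
have e0 : 0 < e by rewrite lt_min divr_gt0//= mulr_gt0.
have [n0 n0P] := powR_small e0.
have ae_phi l : (n0 <= l)%N -> {ae P, forall w,
    log_odds l (Z 0 w) = zeta' w + psi (l.+1%:R `^ (- alpha)) w /\
    `|psi (l.+1%:R `^ (- alpha)) w| <= 4 * v1}.
  move=> nl; have := n0P l nl; rewrite le_min => /andP[c1 c2].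
  apply: filterS ae_env_range => w [x01 y01].
  have c01 : 0 <= (l.+1%:R : R) `^ (- alpha) <= delta / 2 by rewrite powR_ge0.
  have [h1 h2] := log_ratio_perturb d0 d1 c01 x01 y01; split => //.
  apply: (le_trans h2); rewrite ler_pdivrMr//; lra.
have mphi0 l : measurable_fun setT (fun w => log_odds l (Z 0 w)).
  by apply: measurableT_comp; [exact: measurable_log_odds|exact: measurable_env_pair].
have K0 : 0 <= K by exact: le_trans (normr_ge0 _) (zeta'K point).
exists (v / 4), n0; split => [|l nl|l nl].
- by rewrite divr_gt0.
- rewrite (Rintegral_env_pair l (measurable_log_odds l) (log_odds_bound l)).
  rewrite (@ae_eq_Rintegral _ (fun w => zeta' w + psi (l.+1%:R `^ (- alpha)) w)).
  + rewrite RintegralD// ?zeta'_int ?psi_int ?addr0//.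
      exact: (bounded_probability_integrable P mzeta' zeta'K).
    apply: (@bounded_probability_integrable _ _ _ P _ 2) => // w.
    apply: (le_trans (ler_normB _ _)).
    by rewrite -[2]/(1 + 1) lerD// log1p_trunc_bound.
  + exact: mphi0.
  + exact: measurable_funD.
  + by apply: filterS (ae_phi l nl) => w [].
- rewrite (Rintegral_env_pair l (f := fun z => log_odds l z ^+ 2) (M := K ^+ 2)).
  + pose g w := log_odds l (Z 0 w) ^+ 2.
    pose z2 w := zeta' w ^+ 2 / 2 - 16 * v1 ^+ 2.
    have mz2 : measurable_fun setT z2.
      apply: measurable_funB => //; apply: measurable_funM => //.
      exact: measurable_funX.
    (* The inequality z2 <= g holds only almost surely; the minimum equals z2 almost surely and lies
       below g at every point. *)
    pose m w := Num.min (g w) (z2 w).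
    have mg : measurable_fun setT g by exact: measurable_funX.
    have iz : P.-integrable setT (EFin \o (fun w => zeta' w ^+ 2)).
      apply: (@bounded_probability_integrable _ _ _ P _ (K ^+ 2)).
        exact: measurable_funX.
      by move=> w; rewrite normrX lerXn2r ?nnegrE.
    have iz' : P.-integrable setT (EFin \o (fun w => zeta' w ^+ 2 / 2)).
      apply: (@bounded_probability_integrable _ _ _ P _ (K ^+ 2)).
        by apply: measurable_funM => //; exact: measurable_funX.
      move=> w; rewrite normrM normrX [X in _ * X]ger0_norm ?invr_ge0 ?ler0n//.
      have : `|zeta' w| ^+ 2 <= K ^+ 2 by rewrite lerXn2r ?nnegrE.
      by have := sqr_ge0 `|zeta' w|; lra.
    have ic : P.-integrable setT (EFin \o (fun=> 16 * v1 ^+ 2)).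
      by apply: (@bounded_probability_integrable _ _ _ P _ `|16 * v1 ^+ 2|).
    have Ez2 : v / 4 <= \int[P]_w z2 w.
      rewrite RintegralB// RintegralZr// Rintegral_cst_probability -/v; lra.
    have Em : \int[P]_w z2 w = \int[P]_w m w.
      apply: ae_eq_Rintegral => //; first exact: measurable_minr.
      apply: filterS (ae_phi l nl) => w [h1 h2].
      rewrite /m min_r// /z2 /g h1.
      have : psi (l.+1%:R `^ (- alpha)) w ^+ 2 <= 16 * v1 ^+ 2.
        rewrite -real_normK ?num_real//.
        have -> : 16 * v1 ^+ 2 = (4 * v1) ^+ 2 by ring.
        by rewrite lerXn2r ?nnegrE// mulr_ge0// ltW.
      have := sqr_ge0 (zeta' w + 2 * psi (l.+1%:R `^ (- alpha)) w); nra.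
    apply: (le_trans Ez2); rewrite Em; apply: le_Rintegral => //.
    - apply: (@bounded_probability_integrable _ _ _ P _ (K ^+ 2 + `|16 * v1 ^+ 2|)).
        exact: measurable_minr.
      move=> w; rewrite /m /Num.min; case: ifP => _.
        rewrite /g normrX (@le_trans _ _ (K ^+ 2))//.
          by rewrite lerXn2r ?nnegrE ?log_odds_bound.
        by rewrite lerDl.
      rewrite /z2 (le_trans (ler_normB _ _))// lerD//.
      rewrite normrM normrX [X in _ * X]ger0_norm ?invr_ge0 ?ler0n//.
      have : `|zeta' w| ^+ 2 <= K ^+ 2 by rewrite lerXn2r ?nnegrE.
      by have := sqr_ge0 `|zeta' w|; lra.
    - apply: (@bounded_probability_integrable _ _ _ P _ (K ^+ 2)) => // w.
      by rewrite /g normrX lerXn2r ?nnegrE ?log_odds_bound.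
    - by move=> w _; rewrite /m ge_min lexx.
  + exact: measurable_funX (measurable_log_odds l).
  + by move=> z; rewrite normrX lerXn2r ?nnegrE ?log_odds_bound.
Qed.

End EnvironmentPotential.

Theorem theorem4 (R : realType) (d : measure_display) (T : measurableType d)
  (P : probability T R) (delta alpha : R) (xi Y : nat -> {RV P >-> R}) (r : nat)
  (hdelta : 0 < delta < 1 / 2)
  (halpha : 0 < alpha)
  (hiid : iid P (fun i w => (xi i.+1 w, Y i.+1 w)))
  (hxi : P [set w | delta <= xi 1%N w <= 1 - delta] = 1%E)
  (hY : P [set w | -1 <= Y 1%N w <= 1] = 1%E)
  (hzeta : ('E_P[zeta xi 1%N] = 0)%E)
  (hs : (0 < 'V_P[xi 1%N] < +oo)%E)
  (hdist : eq_in_dist P (fun w => Y 1%N w / xi 1%N w)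
                        (fun w => - (Y 1%N w / (1 - xi 1%N w))))
  (hsigma : (0 <= 'V_P[Y 1%N] < +oo)%E) :
  {ae P, forall w,
    forall (d' : measure_display) (T' : measurableType d') (Q : probability T' R)
      (eta : nat -> {RV Q >-> nat}),
      quenched_walk (environment delta alpha xi Y w) r eta ->
      forall eps : R, 0 < eps ->
      {ae Q, forall v, \forall t \near \oo,
        0 <= (eta t v)%:R / ln (t%:R : R) ^+ 2 <= ln (ln (t%:R : R)) `^ (2 + eps)}}
  /\
  {ae P, forall w,
    forall (d' : measure_display) (T' : measurableType d') (Q : probability T' R)
      (eta : nat -> {RV Q >-> nat}),
      quenched_walk (environment delta alpha xi Y w) r eta ->
      forall eps : R, 0 < eps ->
      {ae Q, forall v, infinite_set [set t : nat |
        ln (ln (ln (t%:R : R))) `^ (- 1 - eps) <= (eta t v)%:R / ln (t%:R : R) ^+ 2]}}.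
Proof.
have /andP[hs0 _] := hs; have /andP[d0 d1] := hdelta.
have [v [n0 [v0 mean0 var]]] :=
  log_odds_moments hdelta halpha hiid hxi hY hzeta hs0 hdist.
have mZ := measurable_env_pair xi Y.
have mphi := measurable_log_odds alpha hdelta.
have phiK := log_odds_bound alpha hdelta.
have indep : mutually_independent P (env_pair xi Y) := hiid.1.
have p01 w n : 0 < environment delta alpha xi Y w n < 1.
  have /andP[p0 p1] := environment_itv alpha xi Y hdelta w n.
  by apply/andP; split; lra.
split.
  have [a a0 jumps] := ae_partial_sum_jumps mZ indep mphi phiK mean0 v0 var.
  (* The exceptional null set depends on the potential alone, so it serves every realisation of the
     walk and every eps. *)
  apply: filterS (jumps r) => w [k0 wk] d' T' Q eta walk eps eps0.
  exact: (quenched_upper walk (p01 w) a0 wk eps0).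
apply: filterS (ae_partial_sum_flat mZ indep mphi phiK mean0).
move=> w flat d' T' Q eta walk eps eps0.
have k0 : 0 < delta / 2 by rewrite divr_gt0.
apply: (quenched_lower walk (p01 w) k0 _ flat eps0) => k.
have /andP[_ p1] := environment_itv alpha xi Y hdelta w k.
by rewrite lerBrDl -lerBrDr.
Qed.
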